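(* Let $\mathcal{C}_P^L$, $\mathcal{C}_N^L$, $\mathcal{C}_D^L$ denote the covariance functions of the solution $u_L$ of $(\mathcal{I}-\kappa^{-2}\Delta)^{\alpha/2}u_L=\eta\dot W$ on $D_{ext}=(0,L)^d$ when using, respectively, periodic, homogeneous Neumann and homogeneous Dirichlet boundary conditions on $\partial D_{ext}$, and let $\mathcal{C}$ be the Matérn covariance function on $\mathbb{R}^d$. Then, for $\boldsymbol{x},\boldsymbol{y}\in D_{ext}$, $$\mathcal{C}_{P}^L(\boldsymbol{x},\boldsymbol{y}) = \sum_{\boldsymbol{k}\in\mathbb{Z}^d}\mathcal{C}(\boldsymbol{x}+L\boldsymbol{k},\boldsymbol{y}),$$ $$\mathcal{C}_{N}^{L}(\boldsymbol{x},\boldsymbol{y}) = \sum_{\boldsymbol{\varepsilon}\in B^d} \mathcal{C}_{P}^{2L}(\boldsymbol{x}, \boldsymbol{\varepsilon}.\boldsymbol{y}) = \sum_{\boldsymbol{\varepsilon}\in B^d}\sum_{\boldsymbol{k}\in\mathbb{Z}^d} \mathcal{C}\left(\boldsymbol{x} + 2L\boldsymbol{k},\boldsymbol{\varepsilon}.\boldsymbol{y}\right),$$ $$\mathcal{C}_{D}^{L}(\boldsymbol{x},\boldsymbol{y}) = \sum_{\boldsymbol{\varepsilon}\in B^d}\left(\prod_{i=1}^{d}\varepsilon_i\right)\mathcal{C}_{P}^{2L}(\boldsymbol{x}, \boldsymbol{\varepsilon}.\boldsymbol{y}) = \sum_{\boldsymbol{\varepsilon}\in B^d}\left(\prod_{i=1}^{d}\varepsilon_i\right)\sum_{\boldsymbol{k}\in\mathbb{Z}^d}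 \mathcal{C}\left(\boldsymbol{x} + 2L\boldsymbol{k},\boldsymbol{\varepsilon}.\boldsymbol{y}\right),$$ where $B=\{-1,1\}$ and $\boldsymbol{x}.\boldsymbol{y}=(x_1y_1,\ldots,x_dy_d)^\top$ denotes the element-wise product.
   Context: Parameters: $d\in\{1,2,3\}$, $\sigma^2>0$ (marginal variance), $\nu>0$, $\rho>0$ (correlation length), $\kappa=\sqrt{2\nu}/\rho$, $\alpha=\nu+d/2$, $L>0$, and $\eta>0$ given by $\eta^2=\sigma^2\frac{(4\pi)^{d/2}\Gamma(\nu+d/2)}{\kappa^d\Gamma(\nu)}$. Matérn covariance on $\mathbb{R}^d$: $\mathcal{C}(\boldsymbol{x},\boldsymbol{y})=\sigma^2\mathcal{M}_\nu(\kappa\|\boldsymbol{x}-\boldsymbol{y}\|_2)$, where $\mathcal{M}_\nu(x)=\frac{x^\nu\mathcal{K}_\nu(x)}{2^{\nu-1}\Gamma(\nu)}$ for $x>0$, $\mathcal{M}_\nu(0)=1$ (continuous extension), and $\mathcal{K}_\nu$ is the modified Bessel function of the second kind of order $\nu$. Bounded-domain problem: $D_{ext}=(0,L)^d$ and $u_L$ is the mean-zero Gaussian random field solving $(\mathcal{I}-\kappa^{-2}\Delta)^{\alpha/2}u_L=\eta\dot W$ on $D_{ext}$, where $\dot W$ is Gaussian white noise and the fractional power is defined spectrally, with one of the boundary conditions (holding almost surely, for $j=0,\ldots,\lfloor\frac{\alpha-1}{2}\rfloor$): (D) homogeneous Dirichlet, $(-\Delta)^ju_L=0$ on $\partial D_{ext}$;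 (N) homogeneous Neumann, $\partial_{\boldsymbol n}(-\Delta)^ju_L=0$ on $\partial D_{ext}$; (P) periodic boundary conditions with period $L$ in each coordinate, for $(-\Delta)^j u_L$ and its derivatives. The covariance function $\mathcal{C}^L_\ast$, $\ast\in\{D,N,P\}$, of $u_L$ is the Green's function of $\eta^{-2}(\mathcal{I}-\kappa^{-2}\Delta)^\alpha$ with the corresponding boundary conditions, i.e. $$\mathcal{C}^L_\ast(\boldsymbol{x},\boldsymbol{y})=\eta^2\sum_{\boldsymbol{k}}\lambda_{\boldsymbol{k}}^{-\alpha}w_{\boldsymbol{k}}(\boldsymbol{x})\overline{w_{\boldsymbol{k}}(\boldsymbol{y})},$$ with $(\lambda_{\boldsymbol{k}},w_{\boldsymbol{k}})$ the eigenvalues and $L^2$-normalized eigenfunctions of $\mathcal{I}-\kappa^{-2}\Delta$ on $D_{ext}$: - Dirichlet: $\boldsymbol{k}\in\mathbb{N}^d$ with $\mathbb{N}=\{1,2,\ldots\}$, $w_{\boldsymbol{k}}(\boldsymbol{x})=\prod_{i=1}^d a_{k_i}\sin(\pi k_ix_i/L)$, $\lambda_{\boldsymbol{k}}=1+\left(\frac{\pi}{\kappa L}\right)^2\|\boldsymbol{k}\|_2^2$; - Neumann: $\boldsymbol{k}\in\mathbb{N}_0^d$ with $\mathbb{N}_0=\mathbb{N}\cup\{0\}$, $w_{\boldsymbol{k}}(\boldsymbol{x})=\prod_{i=1}^d a_{k_i}\cos(\pi k_ix_i/L)$, same $\lambda_{\boldsymbol{k}}$ as for Dirichlet; - periodic: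 $\boldsymbol{k}\in\mathbb{Z}^d$, $w_{\boldsymbol{k}}(\boldsymbol{x})=L^{-d/2}e^{\frac{2\pi \mathrm{i}}{L}\boldsymbol{k}\cdot\boldsymbol{x}}$, $\lambda_{\boldsymbol{k}}=1+\left(\frac{2\pi}{\kappa L}\right)^2\|\boldsymbol{k}\|_2^2$; where $a_{k_i}=\sqrt{1/L}$ if $k_i=0$ and $a_{k_i}=\sqrt{2/L}$ otherwise. $\mathcal{C}_P^{2L}$ is the periodic covariance with $L$ replaced by $2L$ (and the same $\eta,\kappa,\alpha$), viewed as a function on $\mathbb{R}^d\times\mathbb{R}^d$ by periodicity. *)

(* Defs.v *)
From HB Require Import structures.
From mathcomp Require Import all_boot all_order all_algebra finmap.
From mathcomp Require Import all_classical all_reals all_analysis.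
From mathcomp.analysis.showcase Require Import summability.
From mathcomp Require Import complex.

Set Implicit Arguments.
Unset Strict Implicit.
Unset Printing Implicit Defensive.

Import Order.TTheory GRing.Theory Num.Theory.
Import numFieldNormedType.Exports.

Local Open Scope classical_set_scope.
Local Open Scope ring_scope.
Local Open Scope complex_scope.

(* Unconditional summation: convergence of the net of finite partial sums. *)
Definition usummable (I : choiceType) (K : numFieldType) (f : I -> K) : Prop :=
  cvg (partial_sum f @ totally).

Definition usum (I : choiceType) (K : numFieldType) (f : I -> K) : K :=
  lim (partial_sum f @ totally).

Section special_functions.
Variable R : realType.
Implicit Types s nu z : R.

Definition Gamma s : R :=
  \int[lebesgue_measure]_(t in `]0, +oo[) (t `^ (s - 1) * expR (- t)).

Definition cosh z : R := (expR z + expR (- z)) / 2.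

(* Modified Bessel function of the second kind, for z > 0: the integral
   definition (DLMF 10.32.9), valid for every real order nu, integers
   included. *)
Definition besselK nu z : R :=
  \int[lebesgue_measure]_(t in `]0, +oo[) (expR (- (z * cosh t)) * cosh (nu * t)).

Definition matern_fun nu z : R :=
  if z == 0 then 1 else z `^ nu * besselK nu z / (2 `^ (nu - 1) * Gamma nu).

End special_functions.

Section vectors.
Variables (R : realType) (d : nat).

Definition sqnorm2 (x : 'rV[R]_d) : R := \sum_i x ord0 i ^+ 2.

Definition norm2 (x : 'rV[R]_d) : R := Num.sqrt (sqnorm2 x).

Definition dotp (x y : 'rV[R]_d) : R := \sum_i x ord0 i * y ord0 i.

Definition hadamard (x y : 'rV[R]_d) : 'rV[R]_d :=
  \row_i (x ord0 i * y ord0 i).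

(* {-1, 1}^d is encoded by boolean vectors, with true standing for -1. *)
Definition signs (b : 'rV[bool]_d) : 'rV[R]_d := \row_i (-1) ^+ b ord0 i.

Definition intvec (k : 'rV[int]_d) : 'rV[R]_d := \row_i (k ord0 i)%:~R.

Definition natvec (k : 'rV[nat]_d) : 'rV[R]_d := \row_i (k ord0 i)%:R.

Definition Dext (L : R) : set 'rV[R]_d := [set x | forall i, 0 < x ord0 i < L].

End vectors.

Section matern_parameters.
Variables (R : realType) (d : nat) (sigma nu rho : R).

Definition kappa : R := Num.sqrt (2 * nu) / rho.

Definition alpha : R := nu + d%:R / 2.

Definition eta_sq : R :=
  sigma ^+ 2 * ((4 * pi) `^ (d%:R / 2) * Gamma (nu + d%:R / 2))
  / (kappa ^+ d * Gamma nu).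

Definition matern_cov (x y : 'rV[R]_d) : R :=
  sigma ^+ 2 * matern_fun nu (kappa * norm2 (x - y)).

End matern_parameters.

(* Covariance eta^2 sum_k lam_k^(-al) w_k(x) conj(w_k(y)) of the solution, i.e.
   the Green's function of eta^-2 A^al for an operator A with eigenvalues lam
   and orthonormal eigenfunctions w. *)
Section green_function.
Variables (R : realType) (d : nat) (I : choiceType).
Variables (eta al : R) (lam : I -> R) (w : I -> 'rV[R]_d -> R[i]).

Definition green_term (x y : 'rV[R]_d) (k : I) : R[i] :=
  (lam k `^ (- al))%:C * w k x * (w k y)^*.

Definition green_cov (x y : 'rV[R]_d) : R[i] :=
  (eta ^+ 2)%:C * usum (green_term x y).

End green_function.

Section eigenpairs.
Variables (R : realType) (d : nat) (kap L : R).

Definition acoef (n : nat) : R := Num.sqrt ((if n == 0%N then 1 else 2) / L).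

Definition expi (t : R) : R[i] := cos t +i* sin t.

(* Multi-indices of the Dirichlet problem: vectors of positive integers. *)
Definition posmulti : Type := {k : 'rV[nat]_d | [forall i, (0 < k ord0 i)%N]}.
HB.instance Definition _ := Choice.on posmulti.

Definition lamN (k : 'rV[nat]_d) : R :=
  1 + (pi / (kap * L)) ^+ 2 * sqnorm2 (natvec R k).

Definition wN (k : 'rV[nat]_d) (x : 'rV[R]_d) : R[i] :=
  (\prod_i (acoef (k ord0 i) * cos (pi * (k ord0 i)%:R * x ord0 i / L)))%:C.

Definition lamD (k : posmulti) : R := lamN (val k).

Definition wD (k : posmulti) (x : 'rV[R]_d) : R[i] :=
  (\prod_i (acoef (val k ord0 i)
            * sin (pi * (val k ord0 i)%:R * x ord0 i / L)))%:C.

Definition lamP (k : 'rV[int]_d) : R :=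
  1 + (2 * pi / (kap * L)) ^+ 2 * sqnorm2 (intvec R k).

Definition wP (k : 'rV[int]_d) (x : 'rV[R]_d) : R[i] :=
  (L `^ (- (d%:R / 2)))%:C * expi (2 * pi / L * dotp (intvec R k) x).

End eigenpairs.

Section covariances.
Variables (R : realType) (d : nat) (nu rho eta L : R).
Let kap := kappa nu rho.
Let al := alpha d nu.

Definition termD := green_term al (@lamD R d kap L) (@wD R d L).
Definition termN := green_term al (@lamN R d kap L) (@wN R d L).
Definition termP := green_term al (@lamP R d kap L) (@wP R d L).

Definition covD := green_cov eta al (@lamD R d kap L) (@wD R d L).
Definition covN := green_cov eta al (@lamN R d kap L) (@wN R d L).
(* The exponentials are L-periodic, so on all of R^d x R^d the function covP
   is the periodic extension. *)
Definition covP := green_cov eta al (@lamP R d kap L) (@wP R d L).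

End covariances.

(* Main.v *)
Require Import Defs.
From HB Require Import structures.
From mathcomp Require Import all_boot all_order all_algebra finmap.
From mathcomp Require Import all_classical all_reals all_analysis.
From mathcomp Require Import measurable_realfun complex.
From mathcomp.analysis.showcase Require Import summability.
From mathcomp Require Import lra ring zify.

Set Implicit Arguments.
Unset Strict Implicit.
Unset Printing Implicit Defensive.

Import Order.TTheory GRing.Theory Num.Theory.
Import numFieldNormedType.Exports.

Local Open Scope classical_set_scope.
Local Open Scope ring_scope.
Local Open Scope complex_scope.

(** Both sides of the periodic formula are integrals over time of a heat kernel. On
    the spectral side, [Gamma alpha * lambda ^ (- alpha)] is the integral of
    [t ^ (alpha - 1) exp (- lambda t)]; summed over the eigenvalues
    [lambda = 1 + c |k|^2] against the plane waves, the integrand becomes a product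
    over the coordinates of one-dimensional theta series. On the side of the images,
    the Matern function at [r] is, up to a constant, the integral of
    [t ^ (nu - 1) exp (- t - r^2 / (4 t))], so that the sum over the lattice is the
    integral of a product of one-dimensional sums of Gaussians. Poisson summation for
    a Gaussian ([poisson_gauss]) says that the two products agree up to the factor
    [t ^ (d / 2)], which is the discrepancy between [alpha] and [nu], and up to
    the constants that [eta] is chosen to absorb ([eta_sqE]).

    The summations over [Z^d] are done on the boxes [[- N, N]^d], where a sum of
    products is a product of finite sums, and [N] tends to infinity under the integral
    by dominated convergence ([theta_integral_cvg]). The domination rests on
    [theta_bound], again a consequence of Poisson summation: [t ^ (1 / 2)] times the
    theta series is at most [K (1 + t)], whose power [d] is integrable against
    [t ^ (nu - 1) exp (- t)] for every [nu > 0]. Bounded absolute partial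
    sums over boxes turn the box limits into unconditional sums
    ([has_usum_exhaust]). Time is written [t = exp u] throughout, so that all
    integrands are smooth on the whole line.

    Poisson summation for [g x = exp (- a (z + x)^2)] is Fejer's theorem at the point
    [0] for the periodization of [g], which is Lipschitz there: the Cesaro means
    of its Fourier series converge to its value ([fejer_cvg]). The Fourier
    coefficients are the integrals of [g x cos (2 pi k x)] over the line; shifting the
    line of integration in the complex plane computes them ([gauss_fourier_cvg]), and
    as they decay like a Gaussian the Fourier series itself converges.

    The Neumann and Dirichlet formulas follow from the periodic one with period [2 L]
    at arbitrary points. In the sum of the periodic series over the reflected
    points of [y], the term of index [k] is a product over the coordinates; summing
    it over the multi-indices with given absolute values [m] yields the term of index
    [m] of the cosine or sine series ([neumann_1d], [dirichlet_1d]), and regrouping an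
    unconditional sum into finite blocks does not change its value
    ([has_usum_regroup]). *)

(** * Lebesgue integrals of real functions *)

Section integrals.
Context {R : realType}.
Notation mu := (@lebesgue_measure R).
Implicit Types (f g F G : R -> R) (a b c : R).

Lemma integrable_itv f a b : continuous f ->
  mu.-integrable `[a, b] (EFin \o f).
Proof.
move=> cf; apply: continuous_compact_integrable; first exact: segment_compact.
by apply: continuous_subspaceT => x; exact: cf.
Qed.

Lemma Rintegral_dominated_cvg (D : set R) (f_ : nat -> R -> R) f g : measurable D ->
  (forall n, measurable_fun D (f_ n)) ->
  (forall x, D x -> f_ ^~ x @ \oo --> f x) ->
  mu.-integrable D (EFin \o g) ->
  (forall n x, D x -> `|f_ n x| <= g x) ->
  \int[mu]_(x in D) f_ n x @[n --> \oo] --> \int[mu]_(x in D) f x.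
Proof.
move=> mD mf ff ig fg.
have mfE : measurable_fun D f by apply: (measurable_fun_cvg mf) => x Dx; exact: ff.
have [|||||i _ c] := @dominated_convergence _ _ R mu D mD
    (fun n => EFin \o f_ n) (EFin \o f) (EFin \o g).
- by move=> n; apply/measurable_EFinP; exact: mf.
- by apply/measurable_EFinP; exact: mfE.
- by apply/aeW => x Dx; apply: cvg_EFin; [exact: nearW|exact: ff].
- by [].
- by apply/aeW => x n Dx; rewrite lee_fin; exact: fg.
apply: fine_cvg; rewrite fineK //.
exact: integrable_fin_num.
Qed.

Lemma Rintegral_sum (I : Type) (s : seq I) (D : set R) (h : I -> R -> R) :
  measurable D -> (forall i, mu.-integrable D (EFin \o h i)) ->
  \int[mu]_(x in D) (\sum_(i <- s) h i x) = \sum_(i <- s) \int[mu]_(x in D) h i x.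
Proof.
move=> mD ih; elim: s => [|i s ihs].
  by under eq_Rintegral do rewrite big_nil; rewrite big_nil Rintegral_cst// mul0r.
under eq_Rintegral do rewrite big_cons; rewrite big_cons -ihs RintegralD//.
have -> : EFin \o (fun x => \sum_(j <- s) h j x) = fun x => (\sum_(j <- s) (h j x)%:E)%E.
  by apply/funext => x; rewrite /= sumEFin.
by apply: (@integrable_sum _ _ _ mu D mD I s xpredT (fun i x => (h i x)%:E)) => j _; exact: ih.
Qed.

Lemma Rintegral_FTC F f a b : a <= b -> continuous f ->
  (forall x : R, is_derive x 1 F (f x)) ->
  \int[mu]_(x in `[a, b]) f x = F b - F a.
Proof.
rewrite le_eqVlt => /predU1P[->|ab] cf dF.
  by rewrite set_itv1 Rintegral_set1 subrr.
have cF : continuous F.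
  by move=> x; apply/differentiable_continuous/derivable1_diffP; have [] := dF x.
rewrite /Rintegral (@continuous_FTC2 _ f F a b ab) //=.
- by apply: continuous_subspaceT => x; exact: cf.
- split; first by move=> x _; have [] := dF x.
  + exact/cvg_at_right_filter/cF.
  + exact/cvg_at_left_filter/cF.
- by move=> x _; rewrite derive1E; have [] := dF x.
Qed.

Lemma Rintegral_shift G a b c : a <= b -> continuous G ->
  \int[mu]_(x in `[a + c, b + c]) G x = \int[mu]_(x in `[a, b]) G (x + c).
Proof.
move=> ab cG; rewrite /Rintegral; congr fine.
have dF (x : R) : is_derive x 1 (fun t : R => t + c) 1.
  exact: is_derive_shift.
have F1E : derive1 (fun t : R => t + c) = cst 1.
  by apply/funext => x; rewrite derive1E; have [_ ->] := dF x.
have cF : continuous (fun t : R => t + c).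
  by move=> x; apply: cvgD; [exact: cvg_id|exact: cvg_cst].
rewrite (@integration_by_substitution_increasing _ (fun t => t + c) G a b ab).
- by rewrite F1E; apply: eq_integral => x _ /=; rewrite mulr1.
- by move=> x y _ _; rewrite ltrD2r.
- by rewrite F1E => x _; exact: cvg_cst.
- by rewrite F1E; exact: is_cvg_cst.
- by rewrite F1E; exact: is_cvg_cst.
- split; first by move=> x _; have [] := dF x.
  + exact/cvg_at_right_filter/cF.
  + exact/cvg_at_left_filter/cF.
- by apply: continuous_subspaceT => x; exact: cG.
Qed.

End integrals.

(** * Symmetric sums over the integers *)

(** The index [i < 2 N + 1] makes a product of such sums expand into a sum over a
    finite box. *)
Definition zsum (V : nmodType) (N : nat) (f : int -> V) : V :=
  \sum_(i < N.*2.+1) f (i%:Z - N%:Z).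

Lemma zsum0 (V : nmodType) (f : int -> V) : zsum 0 f = f 0.
Proof. by rewrite /zsum big_ord1 subrr. Qed.

Lemma zsumS (V : nmodType) N (f : int -> V) :
  zsum N.+1 f = zsum N f + (f N.+1%:Z + f (- N.+1%:Z)).
Proof.
rewrite /zsum doubleS big_ord_recl big_ord_recr /=.
rewrite sub0r addrC -addrA; congr (_ + _).
  by apply: eq_bigr => i _; congr f; rewrite /bump /=; lia.
by congr (f _ + _); rewrite /bump /=; lia.
Qed.

Lemma zsum_pairs (V : nmodType) N (f : int -> V) :
  zsum N f = f 0 + \sum_(k < N) (f k.+1%:Z + f (- k.+1%:Z)).
Proof.
by elim: N => [|N IH]; rewrite ?zsum0 ?big_ord0 ?addr0 // zsumS IH big_ord_recr /= -addrA.
Qed.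

Section zsum_real.
Context {R : realType}.
Implicit Types (f g : int -> R).

Lemma le_zsum N f g : (forall k, f k <= g k) -> zsum N f <= zsum N g.
Proof. by move=> fg; apply: ler_sum. Qed.

Lemma zsum_ge0 N f : (forall k, 0 <= f k) -> 0 <= zsum N f.
Proof. by move=> f0; apply: sumr_ge0. Qed.

Lemma norm_zsum N f : `|zsum N f| <= zsum N (fun k => `|f k|).
Proof. exact: ler_norm_sum. Qed.

Lemma zsumZ N (c : R) f : zsum N (fun k => c * f k) = c * zsum N f.
Proof. by rewrite /zsum mulr_sumr. Qed.

Lemma zsum_bounded_cvg f K : (forall k, 0 <= f k) ->
  (forall N, zsum N f <= K) -> cvg (zsum N f @[N --> \oo]).
Proof.
move=> f0 fK; apply: nondecreasing_is_cvgn.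
  by apply/nondecreasing_seqP => N; rewrite zsumS lerDl addr_ge0.
by exists K => _ [N _ <-]; exact: fK.
Qed.

Lemma geometric_sum_le (q : R) n : 0 <= q < 1 ->
  \sum_(k < n) q ^+ k <= (1 - q)^-1.
Proof.
move=> /andP[q0 q1]; rewrite -[leRHS]mul1r ler_pdivlMr ?subr_gt0//.
rewrite mulrC -[1 - q]opprB mulNr -subrX1 opprB.
by rewrite lerBlDr lerDl exprn_ge0.
Qed.

(** The partial sums of [exp (- b (z + n) ^ 2)] are bounded by comparison with a
    geometric series, since [(z + n) ^ 2 >= n ^ 2 / 2 - z ^ 2]. *)
Lemma gauss_zsum_bounded (b z : R) : 0 < b -> exists K : R, forall N,
  zsum N (fun n => expR (- (b * (z + n%:~R) ^+ 2))) <= K.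
Proof.
move=> b0; set q := expR (- (b / 2)).
have q01 : 0 <= q < 1.
  by rewrite expR_ge0 /= /q expR_lt1 oppr_lt0 divr_gt0.
set E := expR (b * z ^+ 2).
have bnd (n : int) (k : nat) : n%:~R ^+ 2 = k%:R ^+ 2 :> R ->
    expR (- (b * (z + n%:~R) ^+ 2)) <= E * q ^+ k.
  move=> nk; rewrite /E /q -expRM_natl -expRD ler_expR.
  have h1 : k%:R <= k%:R ^+ 2 :> R.
    by rewrite -natrX ler_nat; case: (k) => // m; rewrite leq_pmulr.
  have h2 : 0 <= (z *+ 2 + n%:~R) ^+ 2 by rewrite sqr_ge0.
  have : b * (k%:R / 2 - z ^+ 2) <= b * (z + n%:~R) ^+ 2.
    rewrite ler_pM2l//; rewrite -nk in h1; rewrite -subr_ge0.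
    nra.
  lra.
exists (E + (E * (1 - q)^-1 + E * (1 - q)^-1)) => N.
have E0 : 0 <= E by exact: expR_ge0.
rewrite zsum_pairs; apply: lerD.
  by have := bnd 0 0%N; rewrite expr0 mulr1; apply; rewrite mulr0z.
rewrite big_split /=.
have le1 (f : nat -> R) : (forall k, f k <= E * q ^+ k.+1) ->
    \sum_(k < N) f k <= E * (1 - q)^-1.
  move=> fk; apply: (@le_trans _ _ (E * \sum_(k < N) q ^+ k)).
    rewrite mulr_sumr; apply: ler_sum => k _; apply: (le_trans (fk k)).
    by rewrite ler_wpM2l// exprS ler_piMl ?exprn_ge0 ?expR_ge0//; lra.
  by rewrite ler_wpM2l// geometric_sum_le.
apply: lerD.
  by apply: (le1 (fun k => expR (- (b * (z + (k.+1%:Z)%:~R) ^+ 2)))) => k; exact: bnd.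
apply: (le1 (fun k => expR (- (b * (z + (- k.+1%:Z)%:~R) ^+ 2)))) => k.
by apply: bnd; rewrite mulrNz sqrrN.
Qed.

Lemma gauss_zsum_cvg (b z : R) : 0 < b ->
  cvg (zsum N (fun n => expR (- (b * (z + n%:~R) ^+ 2))) @[N --> \oo]).
Proof.
move=> b0; have [K hK] := gauss_zsum_bounded z b0.
by apply: zsum_bounded_cvg hK => k; exact: expR_ge0.
Qed.

End zsum_real.

(** * The Fejer kernel *)

Section fejer.
Context {R : realType}.
Notation mu := (@lebesgue_measure R).
Implicit Types (a x : R) (N M : nat).

(** The argument is [a = pi x], where [x] has period [1]. *)
Definition dirichlet_kernel N a : R := zsum N (fun k => cos (2 * k%:~R * a)).

(** The division by [M] is left out: it would spoil the identity [fejer_kernelE]. *)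
Definition fejer_kernel M a : R := \sum_(N < M) dirichlet_kernel N a.

(** Telescoping: [2 sin a cos (2 k a) = sin ((2 k + 1) a) - sin ((2 k - 1) a)]. *)
Lemma dirichlet_kernelE N a :
  sin a * dirichlet_kernel N a = sin (N.*2.+1%:R * a).
Proof.
elim: N => [|N IH]; first by rewrite /dirichlet_kernel zsum0 !mulr0 mul0r cos0 mul1r mulr1.
rewrite /dirichlet_kernel zsumS mulrDr [sin a * _]IH mulrNz mulrN mulNr cosN.
have -> : (N.+1.*2.+1%:R : R) * a = 2 * N.+1%:R * a + a by rewrite -natr1 -muln2 natrM; ring.
have -> : (N.*2.+1%:R : R) * a = 2 * N.+1%:R * a - a by rewrite -natr1 -muln2 natrM -[N.+1%:R]natr1; ring.
rewrite sinB sinD; ring.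
Qed.

(** Telescoping again: [sin a sin ((2 N + 1) a)] is the increment of
    [sin (N a) ^ 2]. *)
Lemma fejer_kernelE M a : sin a ^+ 2 * fejer_kernel M a = sin (M%:R * a) ^+ 2.
Proof.
rewrite expr2 -mulrA mulr_sumr; under eq_bigr do rewrite dirichlet_kernelE.
elim: M => [|M IH]; first by rewrite big_ord0 mulr0 mul0r sin0 expr0n.
rewrite big_ord_recr mulrDr IH /=.
have -> : (M.*2.+1%:R : R) * a = M%:R * a + (M%:R * a + a) by rewrite -natr1 -muln2 natrM; ring.
have -> : (M.+1%:R : R) * a = M%:R * a + a by rewrite -natr1; ring.
rewrite (sinD (M%:R * a)) sinD cosD.
have := cos2Dsin2 (M%:R * a); have := cos2Dsin2 a.
set s := sin a; set c := cos a; set S := sin _; set C := cos _ => h1 h2.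
have {h1}h1 : c ^+ 2 = 1 - s ^+ 2 by rewrite -h1; ring.
have {h2}h2 : C ^+ 2 = 1 - S ^+ 2 by rewrite -h2; ring.
have -> : (S * c + C * s) ^+ 2 = S ^+ 2 * c ^+ 2 + C ^+ 2 * s ^+ 2 + 2 * S * C * s * c by ring.
have -> : S ^+ 2 + s * (S * (C * c - S * s) + C * (S * c + C * s)) =
  S ^+ 2 - S ^+ 2 * s ^+ 2 + C ^+ 2 * s ^+ 2 + 2 * S * C * s * c by ring.
rewrite h1 h2; ring.
Qed.

Lemma norm_sin_natM M a : `|sin (M%:R * a)| <= M%:R * `|sin a|.
Proof.
elim: M => [|M IH]; first by rewrite !mul0r sin0 normr0.
rewrite -natr1 !mulrDl !mul1r sinD (le_trans (ler_normD _ _))// lerD//.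
  by rewrite normrM (le_trans _ IH)// ler_piMr// cos_max.
by rewrite normrM ler_piMl// cos_max.
Qed.

(** The bound that makes [|x| fejer_kernel M (pi x) / M] uniformly bounded: one of
    the two factors [sin (M a)] is at most [1], the other at most [M |sin a|]. *)
Lemma norm_sin_fejer_kernel M a : `|sin a| * `|fejer_kernel M a| <= M%:R.
Proof.
have [->|s0] := eqVneq (sin a) 0; first by rewrite normr0 mul0r.
have sa : 0 < `|sin a| by rewrite normr_gt0.
rewrite -(ler_pM2l sa) -normrM -normrM mulrA -expr2 fejer_kernelE normrX.
rewrite expr2 [leRHS]mulrC (le_trans _ (norm_sin_natM M a))//.
by rewrite ler_piMr// sin_max.
Qed.

(** The constant is not sharp. Writing [sin (2 t) = 2 sin t cos t] keeps both
    cosines, that of the formula and that of the mean value theorem for [sin t],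
    above [1 / 2]. *)
Lemma norm_le_sinpi x : -2^-1 <= x <= 2^-1 -> `|x| <= 2 * `|sin (pi * x)|.
Proof.
wlog x0 : x / 0 <= x => [H /andP[h1 h2]|].
  have [x0|x0] := leP 0 x; first by apply: H; rewrite ?h1.
  rewrite -normrN -[in leRHS]normrN -sinN -mulrN; apply: H; first by rewrite oppr_ge0 ltW.
  by rewrite lerN2 lerNl h1 h2.
move=> /andP[_ x2]; have p2 : 2 <= pi :> R by exact: pi_ge2.
have hc (t : R) : 0 <= t <= pi / 4 -> 2^-1 <= cos t.
  move=> /andP[t0 t1].
  have c0 : 0 <= cos t by apply: cos_ge0_pihalf; lra.
  have : 0 <= cos (t *+ 2).
    by apply: cos_ge0_pihalf; rewrite [t *+ 2]mulr2n; lra.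
  rewrite cos_mulr2n => h; rewrite leNgt; apply/negP => h2.
  have : cos t * cos t < 2^-1 * 2^-1 by apply: ltr_pM.
  by move: h; rewrite -[in X in X -> _]mulr_natl expr2; lra.
pose t := pi * x / 2.
have t0 : 0 <= t by rewrite /t; nra.
have t1 : t <= pi / 4 by rewrite /t; nra.
have st0 : sin t = sin t - sin 0 by rewrite sin0 subr0.
have [] := @MVT_segment _ sin cos 0 t t0.
- by apply: continuous_subspaceT; exact: continuous_sin.
move=> c cI; rewrite -st0 => st; have hcc : 2^-1 <= cos c.
  by apply: hc; move: cI; rewrite in_itv /= => /andP[-> /le_trans]; exact.
have st2 : t / 2 <= sin t by rewrite st subr0 mulrC ler_wpM2r.
have -> : pi * x = t *+ 2 by rewrite /t -mulr_natl; field.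
have hct : 2^-1 <= cos t by apply: hc; rewrite t0.
have cs0 : 0 <= cos t * sin t by apply: mulr_ge0; lra.
rewrite sin_mulr2n (ger0_norm x0) ger0_norm ?mulrn_wge0//.
have : 2^-1 * (t / 2) <= cos t * sin t by apply: ler_pM => //; lra.
rewrite -mulr_natl /t; nra.
Qed.

End fejer.

(** * Fejer's theorem *)

Section fourier.
Context {R : realType}.
Notation mu := (@lebesgue_measure R).
Notation D := (`[(- 2^-1)%R, (2^-1)%R]%classic : set R).
Implicit Types (h : R -> R).

Definition fourier_coef h (k : int) : R :=
  \int[mu]_(x in D) (h x * cos (2 * k%:~R * (pi * x))).

Lemma sin_int_pi (k : int) : sin (k%:~R * pi) = 0 :> R.
Proof.
have sn (n : nat) : sin (n%:R * pi) = 0 :> R.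
  elim: n => [|n IH]; first by rewrite mul0r sin0.
  by rewrite -natr1 mulrDl mul1r sinDpi IH oppr0.
case: k => n; first exact: sn.
by rewrite NegzE mulrNz mulNr sinN sn oppr0.
Qed.

Lemma continuous_cos_lin (c : R) : continuous (fun x : R => cos (c * (pi * x))).
Proof.
move=> x; apply: continuous_comp; last exact: continuous_cos.
by apply: cvgM; [exact: cvg_cst|apply: cvgM; [exact: cvg_cst|exact: cvg_id]].
Qed.

Lemma measure_period : mu D = 1%E.
Proof.
rewrite [LHS]lebesgue_measure_itv /= lte_fin ifT; last lra.
by rewrite -EFinD; congr EFin; lra.
Qed.

Lemma fourier_coef1 (k : int) : fourier_coef (cst 1) k = (k == 0)%:R.
Proof.
rewrite /fourier_coef; under eq_Rintegral do rewrite mul1r.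
have [->|k0] := eqVneq k 0.
  under eq_Rintegral do rewrite mulr0 mul0r cos0.
  by rewrite Rintegral_cst// mul1r [X in fine X]measure_period.
set w : R := 2 * k%:~R * pi.
have w0 : w != 0 by rewrite /w !mulf_neq0 ?intr_eq0 ?pnatr_eq0 ?(gt_eqF (pi_gt0 R)).
have dF (x : R) : is_derive x 1 (fun x => w^-1 * sin (w * x))
    (cos (2 * k%:~R * (pi * x))).
  have -> : 2 * k%:~R * (pi * x) = w * x by rewrite /w; ring.
  by apply: is_derive_eq; rewrite /GRing.scale /=; field.
rewrite (Rintegral_FTC _ _ dF); last exact: continuous_cos_lin.
  have e : w * 2^-1 = k%:~R * pi by rewrite /w; field.
  by rewrite mulrN e sinN sin_int_pi /=; ring.
by lra.
Qed.

Lemma zsum_fourier_coef1 N : zsum N (fourier_coef (cst 1)) = 1.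
Proof.
rewrite zsum_pairs fourier_coef1 eqxx big1 ?addr0// => k _.
by rewrite !fourier_coef1 /= addr0.
Qed.

Lemma integrable_period_bounded h K : measurable_fun D h ->
  (forall x, D x -> `|h x| <= K) -> mu.-integrable D (EFin \o h).
Proof.
move=> mh hK; apply: measurable_bounded_integrable => //=.
  by rewrite [X in (X < _)%E]measure_period ltry.
by exists K; split; [exact: num_real|move=> M KM x Dx; exact: le_trans (hK x Dx) (ltW KM)].
Qed.

Lemma norm_mul_cos (u v : R) : `|u * cos v| <= `|u|.
Proof. by rewrite normrM ler_piMr// cos_max. Qed.

Lemma measurable_cos_lin (c : R) : measurable_fun D (fun x : R => cos (c * (pi * x))).
Proof. by apply: measurable_funTS; apply: continuous_measurable_fun; exact: continuous_cos_lin. Qed.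

Lemma integrable_mul_cos h K (c : R) : measurable_fun D h ->
  (forall x, D x -> `|h x| <= K) ->
  mu.-integrable D (EFin \o (fun x => h x * cos (c * (pi * x)))).
Proof.
move=> mh hK; apply: (@integrable_period_bounded _ K).
  by apply: measurable_funM => //; exact: measurable_cos_lin.
by move=> x Dx; rewrite (le_trans (norm_mul_cos _ _))// hK.
Qed.

Lemma sum_zsum_fourier_coef h K M : measurable_fun D h ->
  (forall x, D x -> `|h x| <= K) ->
  \sum_(N < M) zsum N (fourier_coef h) =
  \int[mu]_(x in D) (h x * fejer_kernel M (pi * x)).
Proof.
move=> mh hK; pose c (p : nat) (i : int) x := h x * cos (2 * i%:~R * (pi * x)).
have ic i : mu.-integrable D (EFin \o (fun x => h x * cos (2 * i%:~R * (pi * x)))).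
  exact: integrable_mul_cos mh hK.
have e N : zsum N (fourier_coef h) =
    \int[mu]_(x in D) (h x * dirichlet_kernel N (pi * x)).
  rewrite /zsum /fourier_coef -Rintegral_sum//; apply: eq_Rintegral => x _.
  by rewrite /dirichlet_kernel /zsum mulr_sumr.
under eq_bigr do rewrite e.
have id N : mu.-integrable D (EFin \o (fun x => h x * dirichlet_kernel N (pi * x))).
  rewrite (_ : EFin \o _ = fun x => (\sum_(i < N.*2.+1)
    (h x * cos (2 * (i%:Z - N%:Z)%:~R * (pi * x)))%:E)%E).
    by apply: (@integrable_sum _ _ _ mu D) => // i _; exact: ic.
  by apply/funext => x /=; rewrite sumEFin /dirichlet_kernel /zsum mulr_sumr.
have /= <- := Rintegral_sum (index_enum 'I_M) (measurable_itv _) (fun N : 'I_M => id N).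
by apply: eq_Rintegral => x _; rewrite mulr_sumr.
Qed.

(** Fejer's theorem at a point where the function is Lipschitz: there the
    integrand [h x * fejer_kernel M (pi * x) / M] is dominated uniformly in [M],
    and it tends to [0] at every [x != 0] because of [fejer_kernelE]. *)
Lemma fejer_cvg0 h K : measurable_fun D h ->
  (forall x, D x -> `|h x| <= K * `|x|) ->
  arithmetic_mean (fun N => zsum N (fourier_coef h)) @ \oo --> (0 : R).
Proof.
move=> mh hK.
have K0 : 0 <= K.
  have D2 : D 2^-1 by rewrite /= in_itv /=; lra.
  by have := le_trans (normr_ge0 _) (hK _ D2); rewrite pmulr_lge0// normr_gt0.
have hK2 x : D x -> `|h x| <= K.
  move=> Dx; rewrite (le_trans (hK x Dx))// ler_piMr// ler_norml.
  by move: Dx; rewrite /= in_itv /=; lra.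
have -> : arithmetic_mean (fun N => zsum N (fourier_coef h)) = fun M : nat =>
    \int[mu]_(x in D) (h x * fejer_kernel M.+1 (pi * x) / M.+1%:R).
  apply/funext => M; rewrite /arithmetic_mean /= seriesEord /= (sum_zsum_fourier_coef _ mh hK2).
  rewrite mulrC RintegralZr//.
  rewrite (_ : EFin \o _ = fun x => (\sum_(N < M.+1) \sum_(i < N.*2.+1)
    (h x * cos (2 * (i%:Z - N%:Z)%:~R * (pi * x)))%:E)%E).
    apply: (@integrable_sum _ _ _ mu D) => // N _.
    apply: (@integrable_sum _ _ _ mu D) => // i _; exact: integrable_mul_cos mh hK2.
  apply/funext => x /=; rewrite /fejer_kernel mulr_sumr -sumEFin; apply: eq_bigr => N _.
  by rewrite sumEFin /dirichlet_kernel /zsum mulr_sumr.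
have mF M : measurable_fun D (fun x => h x * fejer_kernel M.+1 (pi * x) / M.+1%:R).
  apply: measurable_funM => //; apply: measurable_funM => //.
  apply: measurable_sum => N; apply: measurable_sum => i; exact: measurable_cos_lin.
have bF M x : D x -> `|h x * fejer_kernel M (pi * x)| <= K * 2 * M%:R.
  move=> Dx; rewrite normrM; apply: (@le_trans _ _ (K * (2 * `|sin (pi * x)|) * `|fejer_kernel M (pi * x)|)).
    rewrite ler_wpM2r// (le_trans (hK x Dx))// ler_wpM2l// norm_le_sinpi//.
  by rewrite !mulrA -mulrA ler_wpM2l ?mulr_ge0// norm_sin_fejer_kernel.
have -> : (0 : R) = \int[mu]_(x in D) cst 0 x by rewrite Rintegral_cst// mul0r.
apply: (@Rintegral_dominated_cvg _ D _ (cst 0) (cst (K * 2)) _ mF) => //.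
- move=> x Dx; have [->|x0] := eqVneq x 0.
    have -> : h 0 = 0.
      have D0 : D 0 by rewrite /= in_itv /=; lra.
      by apply/eqP; have := hK 0 D0; rewrite normr0 mulr0 normr_le0.
    by under eq_fun do rewrite !mul0r; exact: cvg_cst.
  have s0 : 0 < `|sin (pi * x)|.
    have /norm_le_sinpi : - 2^-1 <= x <= 2^-1 by exact: Dx.
    have xx : 0 < `|x| by rewrite normr_gt0.
    by lra.
  apply/norm_cvg0P; pose C := `|h x| / `|sin (pi * x)| ^+ 2.
  apply: (@squeeze_cvgr _ _ _ _ (cst 0) (fun M : nat => C * M.+1%:R^-1)).
  + apply: nearW => M; rewrite normr_ge0 /= !normrM normfV (ger0_norm (ler0n _ _)).
    rewrite ler_wpM2r// /C ler_wpM2l// -[leRHS]mulr1 ler_pdivlMl ?exprn_gt0//.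
    by rewrite -normrX -normrM fejer_kernelE normrX expr_le1// sin_max.
  + exact: cvg_cst.
  + rewrite -[X in _ --> X](mulr0 C); apply: cvgM; first exact: cvg_cst.
    exact: cvg_harmonic.
- apply: (@integrable_period_bounded _ `|K * 2|) => //.
- move=> M x Dx; rewrite normrM normfV (ger0_norm (ler0n _ _)) ler_pdivrMr//.
  exact: bF.
Qed.

Lemma fejer_cvg h K : measurable_fun D h ->
  (forall x, D x -> `|h x - h 0| <= K * `|x|) ->
  arithmetic_mean (fun N => zsum N (fourier_coef h)) @ \oo --> h 0.
Proof.
move=> mh hK; pose g x := h x - h 0.
have mg : measurable_fun D g by apply: measurable_funB.
have gK x : D x -> `|g x| <= `|K|.
  move=> Dx; rewrite (le_trans (hK x Dx))//.
  rewrite (le_trans (ler_wpM2r _ (ler_norm K)))// ler_piMr// ler_norml.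
  by move: Dx; rewrite /= in_itv /=; lra.
have e k : fourier_coef h k = fourier_coef g k + h 0 * fourier_coef (cst 1) k.
  rewrite /fourier_coef -RintegralZl//; last first.
    by apply: (@integrable_mul_cos _ 1) => // x _; rewrite normr1.
  rewrite -RintegralD//.
  - by apply: eq_Rintegral => x _; rewrite /g /=; ring.
  - exact: integrable_mul_cos mg gK.
  - apply: (@integrable_period_bounded _ `|h 0|).
      apply: measurable_funM => //; apply: measurable_funM => //; exact: measurable_cos_lin.
    by move=> x _; rewrite mul1r norm_mul_cos.
have -> : arithmetic_mean (fun N => zsum N (fourier_coef h)) =
    fun n => arithmetic_mean (fun N => zsum N (fourier_coef g)) n + h 0.
  apply/funext => n; rewrite /arithmetic_mean /= !seriesEord /=.
  have eN N : zsum N (fourier_coef h) = zsum N (fourier_coef g) + h 0.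
    rewrite -[in RHS](mulr1 (h 0)) -(zsum_fourier_coef1 N) -zsumZ /zsum -big_split.
    by apply: eq_bigr => i _; exact: e.
  under eq_bigr do rewrite eN.
  rewrite big_split /= sumr_const card_ord mulrDr; congr (_ + _).
  by rewrite -[h 0 *+ _]mulr_natl mulKf// pnatr_eq0.
rewrite -[X in _ --> X](add0r (h 0)); apply: cvgD; last exact: cvg_cst.
exact: fejer_cvg0 mg hK.
Qed.

End fourier.

(** * The Fourier transform of a Gaussian *)

Section gauss_transform.
Context {R : realType}.
Notation mu := (@lebesgue_measure R).
Implicit Types (f : R -> R) (a z s x : R).

(** The half-integer endpoint makes the window [- window n, window n] a union of
    unit periods. *)
Definition window n : R := n%:R + 2^-1.

Lemma window_ge0 n : 0 <= window n.
Proof. by rewrite addr_ge0. Qed.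

Lemma Rintegral_window_cvg f : mu.-integrable setT (EFin \o f) ->
  \int[mu]_(x in `[- window n, window n]) f x @[n --> \oo] --> \int[mu]_x f x.
Proof.
move=> intf; under eq_fun do rewrite Rintegral_mkcond.
have mf : measurable_fun setT f by apply/measurable_EFinP; case/integrableP: intf.
apply: (@Rintegral_dominated_cvg _ setT
    (fun n => f \_ `[- window n, window n]) f (fun x => `|f x|)).
- by [].
- move=> n; apply/measurable_restrict => //.
  exact: measurable_funTS.
- move=> x _; apply: cvg_near_cst; near=> n.
  rewrite /patch ifT// inE /= in_itv /= -ler_norml /window.
  apply: (@le_trans _ _ n%:R); last by rewrite lerDl.
  by near: n; exact: nbhs_infty_ger.
- exact: (@integrable_norm _ _ _ mu setT).
- by move=> n x _; rewrite /patch; case: ifP; rewrite ?normr0.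
Unshelve. all: by end_near. Qed.

Lemma window_gauss_cvg0 a z : 0 < a ->
  expR (- (a * (z + window n) ^+ 2)) @[n --> \oo] --> (0 : R).
Proof.
move=> a0; apply: (@squeeze_cvgr _ _ _ _ (cst 0)
    (fun n => expR (a * z ^+ 2) * expR (- (a / 2)) ^+ n)).
- apply: nearW => n; rewrite expR_ge0 /= -expRM_natl -expRD ler_expR.
  have h2 : 0 <= (z *+ 2 + window n) ^+ 2 by rewrite sqr_ge0.
  have h1 : n%:R <= window n ^+ 2.
    have : 0 <= n%:R :> R by [].
    by rewrite /window; nra.
  have : a * (n%:R / 2 - z ^+ 2) <= a * (z + window n) ^+ 2 by rewrite ler_pM2l//; nra.
  lra.
- exact: cvg_cst.
- rewrite -[X in _ --> X](mulr0 (expR (a * z ^+ 2))).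
  apply: cvgM; first exact: cvg_cst.
  by apply: cvg_expr; rewrite ger0_norm ?expR_ge0// expR_lt1 oppr_lt0 divr_gt0.
Qed.

(** The normal density of mean [- z] and variance [1 / (2 a)]. *)
Lemma Rintegral_gauss a z : 0 < a ->
  mu.-integrable setT (EFin \o (fun x => expR (- (a * (z + x) ^+ 2)))) /\
  \int[mu]_x expR (- (a * (z + x) ^+ 2)) = Num.sqrt (pi / a).
Proof.
move=> a0; pose s := Num.sqrt ((2 * a)^-1).
have s0 : s != 0 by rewrite gt_eqF// sqrtr_gt0 invr_gt0 mulr_gt0.
have s2 : s ^+ 2 *+ 2 = a^-1.
  rewrite sqr_sqrtr ?invr_ge0 ?mulr_ge0 ?ltW// -mulr_natl; field; lra.
have pE : normal_peak s = (Num.sqrt (pi / a))^-1.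
  by rewrite /normal_peak -mulrnAl s2 mulrC.
have sp : 0 < Num.sqrt (pi / a) by rewrite sqrtr_gt0 divr_gt0// pi_gt0.
have e x : expR (- (a * (z + x) ^+ 2)) = Num.sqrt (pi / a) * normal_pdf (- z) s x.
  rewrite normal_pdfE//= pE mulVKf ?gt_eqF// /normal_fun s2.
  by congr expR; rewrite invrK opprK; ring.
have i : mu.-integrable setT (EFin \o (fun x => normal_pdf (- z) s x)).
  exact: integrable_normal_pdf.
split.
  rewrite (_ : EFin \o _ = fun x => ((Num.sqrt (pi / a))%:E * (normal_pdf (- z) s x)%:E)%E).
    exact: integrableZl.
  by apply/funext => x /=; rewrite e.
under eq_Rintegral do rewrite e.
by rewrite RintegralZl// /Rintegral integral_normal_pdf /= mulr1.
Qed.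

End gauss_transform.

Section gauss_fourier.
Context {R : realType}.
Notation mu := (@lebesgue_measure R).
Variables (a z phi : R).
Hypothesis a0 : 0 < a.
Implicit Types (s x : R).

(** [gauss_wave s x] is the real part of [exp (- a (z + x - i s) ^ 2 + i phi)];
    as this is holomorphic in [z + x - i s], its [s]-derivative is an exact
    [x]-derivative, so that its integral over a large window hardly depends on [s]. *)
Definition gauss_wave s x : R :=
  expR (a * (s ^+ 2 - (z + x) ^+ 2)) * cos (2 * a * s * (z + x) + phi).

Definition gauss_wave_primitive s x : R :=
  expR (a * (s ^+ 2 - (z + x) ^+ 2)) * sin (2 * a * s * (z + x) + phi).

Definition gauss_wave_derivative s x : R :=
  expR (a * (s ^+ 2 - (z + x) ^+ 2)) *
  (2 * a * s * cos (2 * a * s * (z + x) + phi)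
   - 2 * a * (z + x) * sin (2 * a * s * (z + x) + phi)).

(** This lemma and the next are the Cauchy-Riemann equation. *)
Lemma is_derive_gauss_wave s x :
  is_derive s 1 (gauss_wave ^~ x) (gauss_wave_derivative s x).
Proof.
apply: is_derive_eq; rewrite /gauss_wave_derivative /GRing.scale /=; ring.
Qed.

Lemma is_derive_gauss_wave_primitive s x :
  is_derive x 1 (gauss_wave_primitive s) (gauss_wave_derivative s x).
Proof.
apply: is_derive_eq; rewrite /gauss_wave_derivative /GRing.scale /=; ring.
Qed.

Lemma continuous_gauss_wave s : continuous (gauss_wave s).
Proof.
move=> x; apply/differentiable_continuous/derivable1_diffP.
rewrite /gauss_wave.
by [].
Qed.

Lemma continuous_gauss_wave_derivative s : continuous (gauss_wave_derivative s).
Proof.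
move=> x; apply/differentiable_continuous/derivable1_diffP.
rewrite /gauss_wave_derivative.
by [].
Qed.

Lemma norm_gauss_wave_derivative s x U A : `|s| <= U -> `|x| <= A ->
  `|gauss_wave_derivative s x| <= expR (a * U ^+ 2) * (2 * a * U + 2 * a * (`|z| + A)).
Proof.
move=> sU xA; rewrite /gauss_wave_derivative normrM ler_pM//.
  rewrite ger0_norm ?expR_ge0// ler_expR ler_pM2l//.
  have : 0 <= (z + x) ^+ 2 by rewrite sqr_ge0.
  have : s ^+ 2 <= U ^+ 2.
    by rewrite -[s ^+ 2]real_normK ?num_real// lerXn2r ?nnegrE// (le_trans _ sU).
  lra.
have a2 : 0 <= 2 * a by rewrite mulr_ge0// ltW.
rewrite (le_trans (ler_normB _ _))// lerD//.
  by rewrite (le_trans (norm_mul_cos _ _))// normrM ger0_norm// ler_wpM2l.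
rewrite normrM (@le_trans _ _ (`|2 * a * (z + x)|))//.
  by rewrite ler_piMr// sin_max.
rewrite normrM ger0_norm// ler_wpM2l// (le_trans (ler_normD _ _))// lerD2l//.
Qed.

Lemma norm_gauss_wave_primitive s x :
  `|gauss_wave_primitive s x| <= expR (a * s ^+ 2) * expR (- (a * (z + x) ^+ 2)).
Proof.
rewrite /gauss_wave_primitive normrM ger0_norm ?expR_ge0// -expRD mulrBr.
by rewrite ler_piMr ?expR_ge0// sin_max.
Qed.

Lemma is_derive_int_gauss_wave A s : 0 <= A ->
  is_derive s 1 (fun s => \int[mu]_(x in `[- A, A]) gauss_wave s x)
    (gauss_wave_primitive s A - gauss_wave_primitive s (- A)).
Proof.
move=> A0; pose U := `|s| + 1.
pose G := expR (a * U ^+ 2) * (2 * a * U + 2 * a * (`|z| + A)).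
have Is : (`](- U), U[%classic : set R) s.
  by rewrite /= in_itv /= /U -ltr_norml ltrDl.
have intf s' : (`](- U), U[%classic : set R) s' ->
    mu.-integrable `[- A, A] (EFin \o gauss_wave s').
  by move=> _; apply: integrable_itv; exact: continuous_gauss_wave.
have derf s' x : (`](- U), U[%classic : set R) s' -> (`[- A, A]%classic : set R) x ->
    derivable (gauss_wave ^~ x) s' 1.
  by move=> _ _; have [] := is_derive_gauss_wave s' x.
have G0 (x : R) : 0 <= cst G x.
  have U0 : 0 <= U by rewrite addr_ge0.
  have a2 : 0 <= 2 * a by rewrite mulr_ge0// ltW.
  have zA : 0 <= `|z| + A by rewrite addr_ge0.
  by rewrite /= /G mulr_ge0 ?expR_ge0// addr_ge0// mulr_ge0.
have intG : mu.-integrable `[- A, A] (EFin \o cst G).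
  by apply: integrable_itv => x; exact: cvg_cst.
have dE s' x : derive1 (gauss_wave ^~ x) s' = gauss_wave_derivative s' x.
  by rewrite derive1E; have [_] := is_derive_gauss_wave s' x.
have Gub s' x : (`](- U), U[%classic : set R) s' -> (`[- A, A]%classic : set R) x ->
    `|partial1of2 gauss_wave s' x| <= cst G x.
  rewrite /= !in_itv /= => sU xA; rewrite /partial1of2 dE.
  apply: norm_gauss_wave_derivative; rewrite ler_norml//.
  by case/andP: sU => /ltW-> /ltW->.
have mAA : measurable (`[- A, A]%classic : set R) by [].
apply: DeriveDef.
  exact: (@derivable_under_integral _ _ _ mu _ _ mAA s _ _ Is intf derf _ G0 intG Gub).
rewrite -derive1E.
rewrite (@differentiation_under_integral _ _ _ mu _ _ mAA s _ _ Is intf derf _ G0 intG Gub).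
rewrite /partial1of2; under eq_Rintegral do rewrite dE.
rewrite (Rintegral_FTC _ _ (is_derive_gauss_wave_primitive s))//; first lra.
exact: continuous_gauss_wave_derivative.
Qed.

(** The [s]-derivative of the integral is the boundary term of
    [gauss_wave_primitive], which is small for a large window. *)
Lemma int_gauss_wave_shift A s : 0 <= A ->
  `|\int[mu]_(x in `[- A, A]) gauss_wave s x
    - \int[mu]_(x in `[- A, A]) gauss_wave 0 x| <=
  `|s| * expR (a * s ^+ 2) *
    (expR (- (a * (z + A) ^+ 2)) + expR (- (a * (z - A) ^+ 2))).
Proof.
move=> A0; set psi := fun s => \int[mu]_(x in `[- A, A]) gauss_wave s x.
set E := _ + expR _.
have dpsi t := is_derive_int_gauss_wave t A0.
have cpsi : continuous psi.
  by move=> t; apply/differentiable_continuous/derivable1_diffP; have [] := dpsi t.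
have dle c : `|c| <= `|s| ->
    `|gauss_wave_primitive c A - gauss_wave_primitive c (- A)| <= expR (a * s ^+ 2) * E.
  move=> cs; rewrite (le_trans (ler_normB _ _))// /E mulrDr lerD//;
    rewrite (le_trans (norm_gauss_wave_primitive _ _))// ler_wpM2r ?expR_ge0//;
    rewrite ler_expR ler_pM2l// -[c ^+ 2]real_normK ?num_real// -[s ^+ 2]real_normK ?num_real//;
    by rewrite lerXn2r ?nnegrE.
have [s0|s0] := leP 0 s.
  have [|c cI ->] := @MVT_segment _ psi _ 0 s s0 (fun x _ => dpsi x).
    exact: continuous_subspaceT.
  rewrite subr0 normrM mulrC -mulrA ler_wpM2l// dle//.
  by move: cI; rewrite in_itv /= => /andP[c0 cs]; rewrite !ger0_norm.
rewrite distrC.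
have [|c cI ->] := @MVT_segment _ psi _ s 0 (ltW s0) (fun x _ => dpsi x).
  exact: continuous_subspaceT.
rewrite sub0r normrM normrN mulrC -mulrA ler_wpM2l// dle//.
move: cI; rewrite in_itv /= => /andP[cs c0]; rewrite !ler0_norm//; last exact: ltW.
by rewrite lerN2.
Qed.

Lemma int_gauss_wave_cvg s :
  \int[mu]_(x in `[- window n, window n]) gauss_wave s x @[n --> \oo]
    --> Num.sqrt (pi / a) * cos phi.
Proof.
pose psi t n := \int[mu]_(x in `[- window n, window n]) gauss_wave t x.
have [ig eg] := Rintegral_gauss z a0.
have w0 : gauss_wave 0 = fun x => cos phi * expR (- (a * (z + x) ^+ 2)).
  apply/funext => x; rewrite /gauss_wave mulr0 mul0r add0r mulrC; congr (_ * expR _); ring.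
have h0 : psi 0 n @[n --> \oo] --> Num.sqrt (pi / a) * cos phi.
  rewrite /psi w0 -eg mulrC -RintegralZl//; apply: Rintegral_window_cvg.
  rewrite (_ : EFin \o _ = fun x => ((cos phi)%:E * (expR (- (a * (z + x) ^+ 2)))%:E)%E).
    exact: integrableZl.
  by apply/funext => x.
rewrite -[X in _ --> X]add0r -/(psi s).
have -> : psi s = fun n => (psi s n - psi 0 n) + psi 0 n.
  by apply/funext => n; rewrite subrK.
apply: cvgD h0; apply/norm_cvg0P.
apply: (@squeeze_cvgr _ _ _ _ (cst 0) (fun n => `|s| * expR (a * s ^+ 2) *
    (expR (- (a * (z + window n) ^+ 2)) + expR (- (a * (z - window n) ^+ 2))))).
- by apply: nearW => n; rewrite normr_ge0 /= int_gauss_wave_shift// window_ge0.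
- exact: cvg_cst.
- rewrite -[X in _ --> X](mulr0 (`|s| * expR (a * s ^+ 2))).
  apply: cvgM; first exact: cvg_cst.
  rewrite -[X in _ --> X](addr0 0); apply: cvgD; first exact: window_gauss_cvg0.
  under eq_fun do rewrite -sqrrN opprB addrC.
  exact: window_gauss_cvg0.
Qed.

End gauss_fourier.

(** At [s = pi k / a] the phase of [gauss_wave] is [2 pi k x] up to a constant: the
    previous limit is the Fourier transform of the Gaussian at integers. *)
Lemma gauss_fourier_cvg (R : realType) (a z : R) (k : int) : 0 < a ->
  \int[@lebesgue_measure R]_(x in `[- window n, window n])
     (expR (- (a * (z + x) ^+ 2)) * cos (2 * k%:~R * (pi * x))) @[n --> \oo]
  --> Num.sqrt (pi / a) * expR (- (pi ^+ 2 / a * k%:~R ^+ 2)) * cos (2 * k%:~R * (pi * z)).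
Proof.
move=> a0; have a1 : a != 0 by rewrite gt_eqF.
set s := pi * k%:~R / a; set phi := - (2 * k%:~R * (pi * z)).
have e x : expR (- (a * (z + x) ^+ 2)) * cos (2 * k%:~R * (pi * x)) =
    expR (- (a * s ^+ 2)) * gauss_wave a z phi s x.
  rewrite /gauss_wave mulrA -expRD; congr (expR _ * cos _).
    ring.
  by rewrite /s /phi; field.
have eI n : \int[@lebesgue_measure R]_(x in `[- window n, window n])
     (expR (- (a * (z + x) ^+ 2)) * cos (2 * k%:~R * (pi * x))) = expR (- (a * s ^+ 2)) *
   \int[@lebesgue_measure R]_(x in `[- window n, window n]) gauss_wave a z phi s x.
  under eq_Rintegral do rewrite e.
  by rewrite RintegralZl//; apply: integrable_itv; exact: continuous_gauss_wave.
under eq_fun do rewrite eI.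
rewrite mulrAC mulrC (_ : pi ^+ 2 / a * _ = a * s ^+ 2); last by rewrite /s; field.
apply: cvgM; first exact: cvg_cst.
rewrite -cosN -/phi; exact: int_gauss_wave_cvg.
Qed.

(** * Poisson summation for a Gaussian *)

Section periodization.
Context {R : realType}.
Notation mu := (@lebesgue_measure R).
Notation D := (`[(- 2^-1)%R, (2^-1)%R]%classic : set R).
Implicit Types (f g : R -> R).

Lemma Rintegral_itv_cat f (a b c : R) : a <= b -> b <= c -> continuous f ->
  \int[mu]_(x in `[a, c]) f x =
  \int[mu]_(x in `[a, b]) f x + \int[mu]_(x in `[b, c]) f x.
Proof.
move=> ab bc cf; have := @Rintegral_itvB _ f (BLeft a) (BRight c) b.
rewrite Rintegral_itv_obnd_cbnd; last first.
  apply: integrableS (integrable_itv b c cf) => //.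
  by apply: subset_itvr; rewrite bnd_simp.
move=> <-//; first by rewrite addrC subrK.
exact: integrable_itv.
Qed.

Lemma Rintegral_window_periodize f n : continuous f ->
  \int[mu]_(x in `[- window n, window n]) f x =
  \int[mu]_(x in D) zsum n (fun m => f (x + m%:~R)).
Proof.
move=> cf; have cs (m : int) : continuous (fun x : R => f (x + m%:~R)).
  move=> x; apply: continuous_comp; last exact: cf.
  by apply: cvgD; [exact: cvg_id|exact: cvg_cst].
have -> : \int[mu]_(x in D) zsum n (fun m => f (x + m%:~R)) =
    zsum n (fun m => \int[mu]_(x in D) f (x + m%:~R)).
  rewrite /zsum.
  have /= -> // := Rintegral_sum (index_enum 'I_n.*2.+1) (measurable_itv `[(- 2^-1 : R), 2^-1])
    (h := fun i x => f (x + (i%:Z - n%:Z)%:~R)) _.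
  by move=> i; exact: integrable_itv.
elim: n => [|n IH].
  by rewrite zsum0 /window add0r; under [RHS]eq_Rintegral do rewrite addr0.
have shift (m : int) (u v : R) : u = - 2^-1 + m%:~R -> v = 2^-1 + m%:~R ->
    \int[mu]_(x in `[u, v]) f x = \int[mu]_(x in D) f (x + m%:~R).
  by move=> -> ->; rewrite Rintegral_shift//; lra.
have w0 := @window_ge0 R n.
have wS : window n.+1 = window n + 1 :> R by rewrite /window -natr1; ring.
have wE : window n = 2^-1 + n%:R :> R by rewrite addrC.
have SE : (n.+1%:Z)%:~R = n%:R + 1 :> R by rewrite natr1.
rewrite zsumS -IH wS.
rewrite (@Rintegral_itv_cat _ _ (window n))//; [|lra|lra].
rewrite (@Rintegral_itv_cat _ _ (- window n))//; [|lra|lra].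
rewrite (shift (- n.+1%:Z) (- (window n + 1)) (- window n)); last 2 first.
- by rewrite mulrNz SE; lra.
- by rewrite mulrNz SE; lra.
rewrite (shift n.+1%:Z (window n) (window n + 1)); last 2 first.
- by rewrite SE; lra.
- by rewrite SE; lra.
by ring.
Qed.

Lemma cosD_int_pi (t : R) (m : int) : cos (t + 2 * (m%:~R * pi)) = cos t.
Proof.
rewrite mulr_natl cosD sin_mulr2n cos_mulr2n cos2sin2 sin_int_pi mulr0 mul0rn mulr0 subr0.
by rewrite expr0n subr0 mulr2n addrK mulr1.
Qed.

Lemma norm_zsum_cvg (f : int -> R) K : (forall N, zsum N (fun k => `|f k|) <= K) ->
  cvg (zsum N f @[N --> \oo]).
Proof.
move=> fK; have e N : zsum N f = zsum N (fun k => f k + `|f k|) - zsum N (fun k => `|f k|).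
  by rewrite /zsum -sumrB; apply: eq_bigr => i _; rewrite addrK.
under eq_fun do rewrite e.
apply: is_cvgB; last exact: zsum_bounded_cvg fK.
apply: (@zsum_bounded_cvg _ _ (K + K)) => [k|N].
  by have := ler_norm (- f k); rewrite normrN; lra.
rewrite /zsum big_split lerD//; last exact: fK.
exact: le_trans (le_zsum N (fun k => ler_norm (f k))) (fK N).
Qed.

End periodization.

Section poisson.
Context {R : realType}.
Notation mu := (@lebesgue_measure R).
Notation D := (`[(- 2^-1)%R, (2^-1)%R]%classic : set R).
Variables (a z : R).
Hypothesis a0 : 0 < a.
Implicit Types (x y : R).

Let g x : R := expR (- (a * (z + x) ^+ 2)).

(** The Lipschitz constant of [gauss_lipschitz]; the factor [1 + 2 / a] bounds
    [|w| exp (- a w ^ 2 / 2)]. *)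
Let C : R := 2 * a * (1 + 2 / a) * expR (a / 8).

(** [(y + xi) ^ 2 >= y ^ 2 / 2 - xi ^ 2]: a move by at most half a period costs half
    of the exponent, which leaves a bound summable over the translates of [y]. *)
Lemma gauss_near_le y (xi : R) : `|xi| <= 2^-1 ->
  expR (- (a * (y + xi) ^+ 2)) <= expR (a / 4) * expR (- (a / 2 * y ^+ 2)).
Proof.
rewrite ler_norml => /andP[x1 x2]; rewrite -expRD ler_expR.
have h : 0 <= (y + xi *+ 2) ^+ 2 by rewrite sqr_ge0.
have h2 : xi ^+ 2 <= 4^-1 by nra.
have : a * (y ^+ 2 / 2 - 4^-1) <= a * (y + xi) ^+ 2 by rewrite ler_pM2l//; nra.
lra.
Qed.

(** Half of the exponent absorbs the factor [y + xi] of the derivative; half of the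
    rest pays for the move by [xi], as in [gauss_near_le]. *)
Lemma gauss_derive_near_le y (xi : R) : `|xi| <= 2^-1 ->
  `|2 * a * (y + xi) * expR (- (a * (y + xi) ^+ 2))| <= C * expR (- (a / 4 * y ^+ 2)).
Proof.
move=> xh; set w := y + xi.
have hw : `|w| * expR (- (a / 2 * w ^+ 2)) <= 1 + 2 / a.
  rewrite expRN ler_pdivrMr ?expR_gt0//.
  apply: (@le_trans _ _ ((1 + 2 / a) * (1 + a / 2 * w ^+ 2))).
    have -> : (1 + 2 / a) * (1 + a / 2 * w ^+ 2) = 1 + w ^+ 2 + 2 / a + a / 2 * w ^+ 2.
      by field; rewrite gt_eqF.
    have h1 : 0 <= 2 / a by rewrite divr_ge0// ltW.
    have h2 : 0 <= a / 2 * w ^+ 2 by rewrite mulr_ge0 ?sqr_ge0// divr_ge0// ltW.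
    have : 0 <= (`|w| - 1) ^+ 2 by rewrite sqr_ge0.
    have := real_normK (num_real w); nra.
  by rewrite ler_wpM2l ?expR_ge1Dx// addr_ge0// divr_ge0// ltW.
have -> : expR (- (a * w ^+ 2)) = expR (- (a / 2 * w ^+ 2)) * expR (- (a / 2 * w ^+ 2)).
  by rewrite -expRD; congr expR; field.
set e := expR (- (a / 2 * w ^+ 2)); have e0 : 0 <= e by exact: expR_ge0.
have -> : `|2 * a * w * (e * e)| = 2 * a * (`|w| * e) * e.
  rewrite normrM (ger0_norm (mulr_ge0 e0 e0)) normrM ger0_norm; first by ring.
  by rewrite mulr_ge0// ltW.
rewrite /C.
rewrite -[leRHS]mulrA ler_pM ?mulr_ge0 ?expR_ge0 ?(ltW a0)//.
  by rewrite ler_wpM2l// mulr_ge0// ltW.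
rewrite -expRD ler_expR.
move: xh; rewrite ler_norml => /andP[x1 x2].
have h : 0 <= (y + xi *+ 2) ^+ 2 by rewrite sqr_ge0.
have h2 : xi ^+ 2 <= 4^-1 by nra.
have : a * (y ^+ 2 / 4 - 8^-1) <= a * (w ^+ 2 / 2) by rewrite ler_pM2l// /w; nra.
lra.
Qed.

Lemma gauss_lipschitz y x : D x ->
  `|expR (- (a * (y + x) ^+ 2)) - expR (- (a * y ^+ 2))| <=
  C * expR (- (a / 4 * y ^+ 2)) * `|x|.
Proof.
rewrite /= in_itv /= -ler_norml => xh.
pose G t : R := expR (- (a * (y + t) ^+ 2)).
have dG (t : R) : is_derive t 1 G (- (2 * a * (y + t) * G t)).
  by rewrite /G; apply: is_derive_eq; rewrite /GRing.scale /=; ring.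
have cG : continuous G.
  by move=> t; apply/differentiable_continuous/derivable1_diffP; have [] := dG t.
have -> : expR (- (a * y ^+ 2)) = G 0 by rewrite /G addr0.
rewrite -/(G x); have [x0|x0] := leP 0 x.
  have [|c cI ->] := @MVT_segment _ G _ 0 x x0 (fun t _ => dG t).
    exact: continuous_subspaceT.
  rewrite subr0 normrM ler_wpM2r// normrN gauss_derive_near_le//.
  by move: cI xh; rewrite in_itv /= => /andP[? ?]; rewrite !ger0_norm//; exact: le_trans.
rewrite distrC.
have [|c cI ->] := @MVT_segment _ G _ x 0 (ltW x0) (fun t _ => dG t).
  exact: continuous_subspaceT.
rewrite sub0r normrM normrN normrN ler_wpM2r// gauss_derive_near_le//.
move: cI xh; rewrite in_itv /= => /andP[? ?]; rewrite !ler0_norm ?(ltW x0)// => h.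
by rewrite (le_trans _ h)// lerN2.
Qed.

(** Poisson summation for a Gaussian. The periodization is Lipschitz at [0], so
    Fejer's theorem recovers its value there as the Cesaro limit of its Fourier
    partial sums, which converge because its coefficients are Gaussian too. *)
Theorem poisson_gauss : exists S : R,
  zsum N (fun n => expR (- (a * (z + n%:~R) ^+ 2))) @[N --> \oo] --> S /\
  Num.sqrt (pi / a) * zsum N (fun k =>
    expR (- (pi ^+ 2 / a * k%:~R ^+ 2)) * cos (2 * k%:~R * (pi * z))) @[N --> \oo] --> S.
Proof.
have a20 : 0 < a / 2 by rewrite divr_gt0.
have a40 : 0 < a / 4 by rewrite divr_gt0.
pose T N x := zsum N (fun n => g (x + n%:~R)).
pose G x := limn (T ^~ x).
have gE x n : g (x + n%:~R) = expR (- (a * (z + n%:~R + x) ^+ 2)).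
  by rewrite /g; congr (expR (- (a * _ ^+ 2))); ring.
have TG x : T ^~ x @ \oo --> G x.
  have := @gauss_zsum_cvg _ a (z + x) a0.
  rewrite (_ : (fun N => zsum N _) = T ^~ x)//.
  apply/funext => N; apply: eq_bigr => i _; rewrite /g; congr (expR (- (a * _ ^+ 2))); ring.
have [K1 hK1] := gauss_zsum_bounded z a20.
have [K2 hK2] := gauss_zsum_bounded z a40.
have TK N x : D x -> `|T N x| <= expR (a / 4) * K1.
  rewrite /= in_itv /= -ler_norml => xh.
  rewrite ger0_norm; last by apply: zsum_ge0 => k; exact: expR_ge0.
  rewrite (@le_trans _ _ (expR (a / 4) * zsum N (fun n => expR (- (a / 2 * (z + n%:~R) ^+ 2)))))//.
    by rewrite -zsumZ; apply: le_zsum => n; rewrite gE; exact: gauss_near_le.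
  by rewrite ler_wpM2l ?expR_ge0.
have C0 : 0 <= C by rewrite !mulr_ge0 ?expR_ge0 ?addr_ge0 ?divr_ge0// ltW.
have Tlip N x : D x -> `|T N x - T N 0| <= C * K2 * `|x|.
  move=> Dx; rewrite (_ : T N x - T N 0 = zsum N (fun n => g (x + n%:~R) - g (0 + n%:~R))).
    rewrite (le_trans (norm_zsum _ _))//.
    rewrite (@le_trans _ _ (C * `|x| * zsum N (fun n => expR (- (a / 4 * (z + n%:~R) ^+ 2)))))//.
      rewrite -zsumZ; apply: le_zsum => n; rewrite !gE addr0.
      by rewrite (le_trans (gauss_lipschitz _ Dx))// mulrAC.
    by rewrite [leRHS]mulrAC ler_wpM2l// mulr_ge0.
  by rewrite /T /zsum -sumrB.
have cT N : continuous (T N).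
  have d x : derivable (T N) x 1.
    rewrite /T /zsum.
    rewrite (_ : (fun x => _) = \sum_(i < N.*2.+1) (fun x => g (x + (i%:Z - N%:Z)%:~R))).
      by apply: derivable_sum => i; rewrite /g.
    by apply/funext => y; rewrite fct_sumE.
  by move=> x; apply/differentiable_continuous/derivable1_diffP.
have mT N : measurable_fun D (T N).
  by apply: measurable_funTS; apply: continuous_measurable_fun; exact: cT.
have mG : measurable_fun D G.
  by apply: (measurable_fun_cvg mT) => x _; exact: TG.
have Glip x : D x -> `|G x - G 0| <= C * K2 * `|x|.
  move=> Dx; have /cvg_norm h : T N x - T N 0 @[N --> \oo] --> G x - G 0.
    by apply: cvgB; exact: TG.
  apply: (cvgr_to_le h).
  by apply: nearW => N; exact: Tlip.
have GF := fejer_cvg mG Glip.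
pose c (k : int) := Num.sqrt (pi / a) * expR (- (pi ^+ 2 / a * k%:~R ^+ 2)) *
  cos (2 * k%:~R * (pi * z)).
have cg : continuous (fun x : R => expR (- (a * (z + x) ^+ 2))).
  by move=> x; apply/differentiable_continuous/derivable1_diffP.
have FE k : fourier_coef G k = c k.
  have h1 := @gauss_fourier_cvg R a z k a0.
  have e n : \int[mu]_(x in `[- window n, window n])
     (expR (- (a * (z + x) ^+ 2)) * cos (2 * k%:~R * (pi * x))) =
     \int[mu]_(x in D) (T n x * cos (2 * k%:~R * (pi * x))).
    rewrite Rintegral_window_periodize; last first.
      move=> x; apply: cvgM; last exact: continuous_cos_lin.
      exact: cg.
    apply: eq_Rintegral => x _; rewrite /T /zsum mulr_suml; apply: eq_bigr => i _.
    congr (_ * _); rewrite -[RHS](cosD_int_pi _ (k * (i%:Z - n%:Z))) intrM; congr cos; ring.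
  have h2 : \int[mu]_(x in D) (T n x * cos (2 * k%:~R * (pi * x))) @[n --> \oo]
      --> fourier_coef G k.
    apply: (@Rintegral_dominated_cvg _ D (fun n x => T n x * cos (2 * k%:~R * (pi * x)))
        (fun x => G x * cos (2 * k%:~R * (pi * x))) (cst (expR (a / 4) * K1))).
    - by [].
    - by move=> n; apply: measurable_funM => //; exact: measurable_cos_lin.
    - by move=> x _; apply: cvgM; [exact: TG|exact: cvg_cst].
    - by apply: integrable_itv => x; exact: cvg_cst.
    - by move=> n x Dx; rewrite (le_trans (norm_mul_cos _ _))// TK.
  move: h1; under eq_fun do rewrite e.
  by move=> h1; exact: (cvg_unique _ h2 h1).
have c_cvg : cvg (zsum N c @[N --> \oo]).
  have pa : 0 < pi ^+ 2 / a by rewrite divr_gt0// exprn_gt0// pi_gt0.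
  have [K hK] := gauss_zsum_bounded 0 pa.
  apply: (@norm_zsum_cvg _ _ (Num.sqrt (pi / a) * K)) => N.
  rewrite (@le_trans _ _ (Num.sqrt (pi / a) * zsum N (fun n => expR (- (pi ^+ 2 / a * (0 + n%:~R) ^+ 2)))))//.
    rewrite -zsumZ; apply: le_zsum => k; rewrite add0r (le_trans (norm_mul_cos _ _))//.
    by rewrite ger0_norm// mulr_ge0 ?expR_ge0 ?sqrtr_ge0.
  by rewrite ler_wpM2l ?sqrtr_ge0.
exists (G 0); split.
  have := TG 0; rewrite (_ : T ^~ 0 = fun N => zsum N (fun n => expR (- (a * (z + n%:~R) ^+ 2))))//.
  by apply/funext => N; apply: eq_bigr => i _; rewrite gE addr0.
have cS : zsum N c @[N --> \oo] --> G 0.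
  have -> : G 0 = limn (fun N => zsum N c); last exact: c_cvg.
  have := cesaro c_cvg.
  rewrite (_ : (fun N => zsum N c) = (fun N => zsum N (fourier_coef G))).
    by move=> h; exact: (cvg_unique _ GF h).
  by apply/funext => N; apply: eq_bigr => i _; rewrite FE.
apply: cvg_trans cS; apply: near_eq_cvg; apply: nearW => N.
by rewrite -zsumZ; apply: eq_bigr => i _; rewrite mulrA.
Qed.

End poisson.

(** * Substitutions on the real line *)

Section real_line_integrals.
Context {R : realType}.
Notation mu := (@lebesgue_measure R).
Implicit Types (f g h G : R -> R) (s l c q r u : R).

Lemma near_window (x : R) : \forall n \near \oo, - window n <= x <= window n.
Proof.
near=> n; rewrite -ler_norml (@le_trans _ _ n%:R)// /window ?lerDl//.
by near: n; exact: nbhs_infty_ger.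
Unshelve. all: by end_near. Qed.

Lemma le_window : {homo @window R : m n / (m <= n)%N >-> m <= n}.
Proof. by move=> m n mn; rewrite lerD2r ler_nat. Qed.

Lemma integrable_continuous_le f g : continuous f -> (forall x, `|f x| <= g x) ->
  mu.-integrable setT (EFin \o g) -> mu.-integrable setT (EFin \o f).
Proof.
move=> cf fg ig; apply: (@le_integrable _ _ _ mu setT _ _ (EFin \o g)) => //.
  by apply/measurable_EFinP; exact: continuous_measurable_fun.
by move=> x _; rewrite lee_fin (le_trans (fg x))// ler_norm.
Qed.

Lemma integrable_continuous_ge0 f : continuous f -> (forall x, 0 <= f x) ->
  (\int[mu]_x (f x)%:E < +oo)%E -> mu.-integrable setT (EFin \o f).
Proof.
move=> cf f0 foo; apply/integrableP; split.
  by apply/measurable_EFinP; exact: continuous_measurable_fun.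
by under eq_integral do rewrite gee0_abs ?lee_fin//.
Qed.

Lemma integral_window_cvg f : continuous f -> (forall x, 0 <= f x) ->
  (\int[mu]_(x in `[(- window n)%R, window n]) (f x)%:E)%E @[n --> \oo] -->
  (\int[mu]_x (f x)%:E)%E.
Proof.
move=> cf f0.
have -> : [set: measurableTypeR R] = \bigcup_n `[- window n, (window n : R)]%classic.
  apply/esym; rewrite -subTset => x _; have [n _ hn] := near_window x.
  by exists n => //=; rewrite in_itv /= hn/=.
apply: ge0_nondecreasing_set_cvg_integral => //.
- move=> m n mn; rewrite subsetEset; apply: subset_itv; rewrite bnd_simp.
    by rewrite lerN2 le_window.
  exact: le_window.
- move=> n; apply/measurable_EFinP; apply: measurable_funTS.
  exact: continuous_measurable_fun.
- by move=> n x _; rewrite lee_fin.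
Qed.

(** The substitution [t = exp u], by exhaustion of the half-line by compact
    intervals. *)
Lemma integral_half_line_expR G : (forall t : R, 0 < t -> {for t, continuous G}) ->
  (forall t, 0 < t -> 0 <= G t) ->
  (\int[mu]_(t in `]0%R, +oo[) (G t)%:E = \int[mu]_u (G (expR u) * expR u)%:E)%E.
Proof.
move=> cG G0.
have cH : continuous (fun u => G (expR u) * expR u).
  move=> u; apply: cvgM; last exact: continuous_expR.
  by apply: continuous_comp; [exact: continuous_expR|exact: cG (expR_gt0 _)].
have H0 u : 0 <= G (expR u) * expR u by rewrite mulr_ge0 ?expR_ge0// G0 ?expR_gt0.
have h1 := integral_window_cvg cH H0.
have h2 : (\int[mu]_(t in `[expR (- window n), expR (window n)]) (G t)%:E)%E @[n --> \oo]
    --> (\int[mu]_(t in `]0%R, +oo[) (G t)%:E)%E.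
  have -> : (`]0%R, +oo[%classic : set R) =
      \bigcup_n `[expR (- window n), expR (window n)]%classic.
    apply/seteqP; split => [t /=|t [n _] /=]; rewrite !in_itv /=.
      rewrite andbT => t0; have [n _ hn] := near_window (ln t).
      have /(_ (leqnn n)) /andP[h1' h2'] := hn n.
      exists n => //=; rewrite in_itv /= -[t]lnK ?posrE// !ler_expR.
      by rewrite h1' h2'.
    by move=> /andP[h _]; rewrite andbT (lt_le_trans (expR_gt0 _) h).
  have sub n : (`[expR (- window n), expR (window n)]%classic : set R) `<=` `]0, +oo[%classic.
    by move=> t; rewrite /= !in_itv /= => /andP[h _]; rewrite andbT (lt_le_trans (expR_gt0 _) h).
  have mG : measurable_fun (`]0, +oo[%classic : set R) G.
    apply: open_continuous_measurable_fun; first exact: interval_open.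
    by move=> t; rewrite inE /= in_itv /= andbT => /cG.
  apply: ge0_nondecreasing_set_cvg_integral => //.
  - move=> m n mn; rewrite subsetEset; apply: subset_itv; rewrite bnd_simp.
      by rewrite ler_expR lerN2 le_window.
    by rewrite ler_expR le_window.
  - by move=> n; apply/measurable_EFinP; exact: measurable_funS mG.
  - by move=> n t /sub; rewrite /= in_itv /= andbT lee_fin => /G0.
have d1 : derive1 (@expR R) = expR.
  by apply/funext => x; rewrite derive1E; have [_ ->] := is_derive_expR x.
have e n : (\int[mu]_(t in `[expR (- window n), expR (window n)]) (G t)%:E)%E =
  (\int[mu]_(x in `[(- window n)%R, window n]) (G (expR x) * expR x)%:E)%E.
  rewrite (@integration_by_substitution_increasing _ expR G).
  - by rewrite d1.
  - by have := @window_ge0 R n; lra.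
  - by move=> x y _ _; rewrite ltr_expR.
  - by rewrite d1 => x _; exact: continuous_expR.
  - by rewrite d1; apply/cvg_ex; eexists; apply: cvg_at_right_filter; exact: continuous_expR.
  - by rewrite d1; apply/cvg_ex; eexists; apply: cvg_at_left_filter; exact: continuous_expR.
  - split; first by [].
    + by apply: cvg_at_right_filter; exact: continuous_expR.
    + by apply: cvg_at_left_filter; exact: continuous_expR.
  - apply: continuous_in_subspaceT => t; rewrite inE /= in_itv /= => /andP[h _].
    exact/cG/(lt_le_trans (expR_gt0 _) h).
move: h2; under eq_fun do rewrite e.
by move=> h2; exact: (cvg_unique _ h2 h1).
Qed.

Lemma integral_translate f c : continuous f -> (forall x, 0 <= f x) ->
  (\int[mu]_x (f x)%:E = \int[mu]_x (f (x + c))%:E)%E.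
Proof.
move=> cf f0.
have F1E : derive1 (fun t : R => t + c) = cst 1.
  by apply/funext => x; rewrite derive1E; have [_ ->] := is_derive_shift x 1 c.
have cF : continuous (fun t : R => t + c).
  by move=> x; apply: cvgD; [exact: cvg_id|exact: cvg_cst].
rewrite (@increasing_ge0_integration_by_substitutionT _ (fun t => t + c) f)//.
- by rewrite F1E; apply: eq_integral => x _ /=; rewrite mulr1.
- by move=> x y; rewrite ltrD2r.
- by rewrite F1E; exact: cst_continuous.
- by rewrite F1E; exact: is_cvg_cst.
- by rewrite F1E; exact: is_cvg_cst.
- exact: cvg_addrr_Ny.
- exact: cvg_addrr.
Qed.

Lemma Rintegral_translate f c : continuous f -> (forall x, 0 <= f x) ->
  \int[mu]_x f x = \int[mu]_x f (x + c).
Proof. by move=> cf f0; rewrite /Rintegral (integral_translate c). Qed.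

End real_line_integrals.

(** * Integral representations of the Gamma and Bessel functions *)

Section gamma_bessel.
Context {R : realType}.
Notation mu := (@lebesgue_measure R).
Implicit Types (s l c q r u nu : R).

Lemma powR_expR (a x : R) : 0 < a -> a `^ x = expR (x * ln a).
Proof. by move=> a0; rewrite /powR gt_eqF. Qed.

Lemma integrable_exp_norm s : 0 < s ->
  mu.-integrable setT (EFin \o (fun u => expR (- (s * `|u|)))).
Proof.
move=> s0; have cf : continuous (fun u : R => expR (- (s * `|u|))).
  move=> u; apply: continuous_comp; last exact: continuous_expR.
  by apply: cvgN; apply: cvgM; [exact: cvg_cst|exact: norm_continuous].
apply: integrable_continuous_ge0 => //.
rewrite ge0_symfun_integralT//; last by move=> u /=; rewrite normrN.
have -> : [set x : R | 0 <= x] = `[0, +oo[%classic.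
  by apply/seteqP; split => x /=; rewrite in_itv/= andbT.
have -> : (\int[mu]_(x in `[0%R, +oo[) (expR (- (s * `|x|)))%:E =
    \int[mu]_(x in `[0%R, +oo[) (expR (- (s * x)))%:E)%E.
  by apply: eq_integral => x; rewrite inE /= in_itv /= andbT => x0; rewrite ger0_norm.
have dF (x : R) : is_derive x 1 (fun x => - s^-1 * expR (- (s * x))) (expR (- (s * x))).
  by apply: is_derive_eq; rewrite /GRing.scale /=; field; rewrite gt_eqF.
have cF : continuous (fun x : R => - s^-1 * expR (- (s * x))).
  by move=> t; apply/differentiable_continuous/derivable1_diffP; have [] := dF t.
rewrite (@ge0_continuous_FTC2y _ _ (fun x => - s^-1 * expR (- (s * x))) 0 0).
- by rewrite mulr0 oppr0 expR0 -EFinB -EFinM ltry.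
- by move=> x _; exact: expR_ge0.
- apply: continuous_subspaceT => x.
  by apply/differentiable_continuous/derivable1_diffP.
- rewrite -[X in _ --> X](mulr0 (- s^-1)); apply: cvgM; first exact: cvg_cst.
  apply/cvgrPdist_lt => e e0; near=> x.
  rewrite sub0r normrN ger0_norm ?expR_ge0// -[e]lnK ?posrE// ltr_expR.
  rewrite ltrNl -ltr_pdivrMl//.
  by near: x; exact: nbhs_pinfty_gt (num_real _).
- by move=> x _; have [] := dF x.
- exact/cvg_at_right_filter/cF.
- by move=> x _; rewrite derive1E; have [_ ->] := dF x.
Unshelve. all: by end_near. Qed.

(** The integrand of [int_0^oo t^(s-1) exp (- l t) dt] after [t = exp u]. *)
Definition gamma_kernel s l u : R := expR (s * u - l * expR u).

Lemma continuous_gamma_kernel s l : continuous (gamma_kernel s l).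
Proof.
by move=> u; apply/differentiable_continuous/derivable1_diffP; rewrite /gamma_kernel.
Qed.

Lemma integrable_gamma_kernel s l : 0 < s -> 0 < l ->
  mu.-integrable setT (EFin \o gamma_kernel s l).
Proof.
move=> s0 l0; pose K := expR (4 * s ^+ 2 / l).
apply: (@integrable_continuous_le _ _ (fun u => K * expR (- (s * `|u|)))).
- exact: continuous_gamma_kernel.
- move=> u; rewrite ger0_norm ?expR_ge0// /gamma_kernel /K -expRD ler_expR.
  have e0 := expR_ge0 u.
  have hl : 0 <= l * expR u by rewrite mulr_ge0// ltW.
  have hs : 0 <= 4 * s ^+ 2 / l by rewrite divr_ge0 ?mulr_ge0 ?sqr_ge0// ltW.
  have [u0|u0] := leP 0 u; last first.
    by rewrite ltr0_norm// mulrN opprK; lra.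
  rewrite ger0_norm//.
  (* [exp u >= (1 + u / 2) ^ 2 >= u ^ 2 / 4] beats the linear term. *)
  have h : u ^+ 2 / 4 <= expR u.
    have -> : expR u = expR (u / 2) ^+ 2 by rewrite -expRM_natl; congr expR; field.
    have := expR_ge1Dx (u / 2); have := expR_ge0 (u / 2).
    set e := expR _ => h1 h2.
    have : (u / 2) ^+ 2 <= e ^+ 2 by rewrite lerXn2r ?nnegrE//; lra.
    by rewrite !expr2; lra.
  have h3 : l * (u ^+ 2 / 4) <= l * expR u by rewrite ler_pM2l.
  suff : 2 * s * u <= 4 * s ^+ 2 / l + l * (u ^+ 2 / 4) by lra.
  have : 0 <= (4 * s - l * u) ^+ 2 / (4 * l).
    by rewrite divr_ge0 ?sqr_ge0// mulr_ge0// ltW.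
  have -> : (4 * s - l * u) ^+ 2 / (4 * l) =
    4 * s ^+ 2 / l + l * (u ^+ 2 / 4) - 2 * s * u by field; rewrite gt_eqF.
  lra.
- rewrite (_ : EFin \o _ = fun u => (K%:E * (expR (- (s * `|u|)))%:E)%E) //.
  by apply: integrableZl => //; exact: integrable_exp_norm.
Qed.

Lemma Gamma_expR s : 0 < s -> Gamma s = \int[mu]_u gamma_kernel s 1 u.
Proof.
move=> s0; rewrite /Gamma /Rintegral; congr fine.
rewrite (@integral_half_line_expR _ (fun t => t `^ (s - 1) * expR (- t))).
- apply: eq_integral => u _; congr EFin; rewrite /gamma_kernel powR_expR ?expR_gt0//.
  by rewrite expRK -!expRD; congr expR; ring.
- move=> t t0; have cp : {for t, continuous (fun t : R => t `^ (s - 1))}.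
    apply/differentiable_continuous/derivable1_diffP; apply: derivable_powR.
    by rewrite in_itv /= andbT.
  apply: cvgM; first exact: cp.
  by apply: continuous_comp; [apply: cvgN; exact: cvg_id|exact: continuous_expR].
- by move=> t _; rewrite mulr_ge0 ?powR_ge0 ?expR_ge0.
Qed.

Lemma Gamma_gt0 s : 0 < s -> 0 < Gamma s.
Proof.
move=> s0; rewrite Gamma_expR//.
have ig := integrable_gamma_kernel s0 (@ltr01 R).
apply: (@lt_le_trans _ _ (\int[mu]_(u in `[0, 1]) gamma_kernel s 1 u)).
  apply: (@lt_le_trans _ _ (\int[mu]_(u in `[0, 1]) expR (- expR 1))).
    rewrite Rintegral_cst// [X in fine X](_ : _ = 1%E) ?mulr1 ?expR_gt0//.
    by rewrite [LHS]lebesgue_measure_itv /= lte_fin ltr01 sube0.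
  apply: le_Rintegral => //.
  - by apply: integrable_itv => x; exact: cvg_cst.
  - exact: integrable_itv (@continuous_gamma_kernel _ _).
  - move=> x; rewrite /= in_itv /= => /andP[x0 x1]; rewrite /gamma_kernel ler_expR.
    have : expR x <= expR 1 by rewrite ler_expR.
    have : 0 <= s * x by rewrite mulr_ge0// ltW.
    lra.
rewrite Rintegral_mkcond; apply: le_Rintegral => //.
- rewrite (_ : EFin \o _ = (EFin \o gamma_kernel s 1) \_ `[0, 1]); last first.
    by apply/funext => x; rewrite /= !patchE; case: ifP.
  exact: (@integrable_mkcond _ _ _ mu (`[0, 1]%classic) (EFin \o gamma_kernel s 1) (measurable_itv _)).1 (integrableS _ _ _ ig).
- by move=> x _; rewrite patchE; case: ifP => // _; exact: expR_ge0.
Qed.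

Lemma Rintegral_gamma_kernel s l : 0 < s -> 0 < l ->
  \int[mu]_u gamma_kernel s l u = l `^ (- s) * Gamma s.
Proof.
move=> s0 l0; rewrite (Rintegral_translate (- ln l)); last 2 first.
- exact: continuous_gamma_kernel.
- by move=> u; exact: expR_ge0.
rewrite Gamma_expR// -RintegralZl//; last exact: integrable_gamma_kernel.
apply: eq_Rintegral => u _; rewrite /gamma_kernel powR_expR// -expRD expRD expRN lnK ?posrE//.
by congr expR; field; rewrite gt_eqF.
Qed.

(** The integrand of [int_0^oo t^(nu-1) exp (- t - q / t) dt] after [t = exp u]. *)
Definition bessel_kernel nu q u : R := expR (nu * u - expR u - q * expR (- u)).

Lemma continuous_bessel_kernel nu q : continuous (bessel_kernel nu q).
Proof.
by move=> u; apply/differentiable_continuous/derivable1_diffP; rewrite /bessel_kernel.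
Qed.

Lemma bessel_kernel_le nu q u : 0 <= q -> bessel_kernel nu q u <= gamma_kernel nu 1 u.
Proof.
move=> q0; rewrite /bessel_kernel /gamma_kernel ler_expR mul1r.
by rewrite gerBl mulr_ge0 ?expR_ge0.
Qed.

Lemma integrable_bessel_kernel nu q : 0 < nu -> 0 <= q ->
  mu.-integrable setT (EFin \o bessel_kernel nu q).
Proof.
move=> nu0 q0; apply: integrable_continuous_le (integrable_gamma_kernel nu0 ltr01).
  exact: continuous_bessel_kernel.
by move=> u; rewrite ger0_norm ?expR_ge0// bessel_kernel_le.
Qed.

Lemma integral_reflect (f : R -> R) : continuous f -> (forall x, 0 <= f x) ->
  (\int[mu]_u (f (- u))%:E = \int[mu]_u (f u)%:E)%E.
Proof.
move=> cf f0; have cfN : continuous (fun u => f (- u)).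
  by move=> u; apply: continuous_comp; [apply: cvgN; exact: cvg_id|exact: cf].
have h1 := integral_window_cvg cf f0.
have h2 := integral_window_cvg cfN (fun u => f0 (- u)).
have e n : (\int[mu]_(x in `[(- window n)%R, window n]) (f x)%:E =
    \int[mu]_(x in `[(- window n)%R, window n]) (f (- x))%:E)%E.
  have := @integration_by_substitution_oppr _ f (- window n) (window n).
  rewrite opprK => -> //; first by have := @window_ge0 R n; lra.
  exact: continuous_subspaceT.
move: h1; under eq_fun do rewrite e.
by move=> h1; exact: (cvg_unique _ h2 h1).
Qed.

(** Translating by [ln (r / 2)] turns the exponent into [nu u - r cosh u]; averaging
    with [u -> - u] produces the even integrand of [besselK]. *)
Lemma Rintegral_bessel_kernel nu r : 0 < nu -> 0 < r ->
  \int[mu]_u bessel_kernel nu (r ^+ 2 / 4) u = 2 * (r / 2) `^ nu * besselK nu r.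
Proof.
move=> nu0 r0; have r2 : 0 < r / 2 by rewrite divr_gt0.
have q0 : 0 <= r ^+ 2 / 4 by rewrite divr_ge0// sqr_ge0.
pose h u := expR (nu * u - r * cosh u).
have hN u : cosh (- u) = cosh u :> R by rewrite /cosh opprK addrC.
have e u : bessel_kernel nu (r ^+ 2 / 4) (u + ln (r / 2)) = (r / 2) `^ nu * h u.
  rewrite /bessel_kernel /h powR_expR// -[RHS]expRD; congr expR.
  rewrite opprD !expRD [expR (- ln _)]expRN lnK ?posrE// /cosh; field.
  by rewrite gt_eqF.
have ch : continuous h.
  by move=> u; apply/differentiable_continuous/derivable1_diffP; rewrite /h /cosh.
have ibt : mu.-integrable setT (EFin \o (fun u => bessel_kernel nu (r ^+ 2 / 4) (u + ln (r / 2)))).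
  apply: integrable_continuous_ge0.
  - move=> u; apply: continuous_comp; last exact: continuous_bessel_kernel.
    by apply: cvgD; [exact: cvg_id|exact: cvg_cst].
  - by move=> u; exact: expR_ge0.
  - rewrite -(integral_translate (ln (r / 2)) (@continuous_bessel_kernel nu (r ^+ 2 / 4))).
      have /integrableP[_] := integrable_bessel_kernel nu0 q0.
      by under eq_integral do rewrite gee0_abs ?lee_fin ?expR_ge0//.
    by move=> u; exact: expR_ge0.
have rn : (r / 2) `^ nu != 0 by rewrite powR_expR// gt_eqF// expR_gt0.
have ih : mu.-integrable setT (EFin \o h).
  rewrite (_ : EFin \o h = fun u => (((r / 2) `^ nu)^-1%:E *
      (bessel_kernel nu (r ^+ 2 / 4) (u + ln (r / 2)))%:E)%E); first exact: integrableZl.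
  by apply/funext => u /=; rewrite e -EFinM mulKf.
rewrite (Rintegral_translate (ln (r / 2)) (@continuous_bessel_kernel nu (r ^+ 2 / 4))); last first.
  by move=> u; exact: expR_ge0.
under eq_Rintegral do rewrite e.
rewrite RintegralZl// -[RHS]mulrA [RHS]mulrCA; congr (_ * _).
pose k u := expR (- (r * cosh u)) * cosh (nu * u).
have kE u : k u = 2^-1 * (h u + h (- u)).
  by rewrite /k /h hN {2}/cosh mulrN !expRD; field.
have k0 u : 0 <= k u by rewrite kE mulr_ge0// addr_ge0// expR_ge0.
have ck : continuous k.
  by move=> u; apply/differentiable_continuous/derivable1_diffP; rewrite /k /cosh.
have h0 u : 0 <= h u by exact: expR_ge0.
have ihN : mu.-integrable setT (EFin \o (fun u => h (- u))).
  apply: integrable_continuous_ge0 => //.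
    by move=> u; apply: continuous_comp; [apply: cvgN; exact: cvg_id|exact: ch].
  rewrite integral_reflect//.
  by have /integrableP[_] := ih; under eq_integral do rewrite gee0_abs ?lee_fin//.
have ihh : mu.-integrable setT (EFin \o (fun u => h u + h (- u))).
  rewrite (_ : EFin \o _ = fun u => ((h u)%:E + (h (- u))%:E)%E); first exact: integrableD.
  by apply/funext.
have ik : mu.-integrable setT (EFin \o k).
  rewrite (_ : EFin \o k = fun u => ((2^-1)%:E * ((h u)%:E + (h (- u))%:E))%E).
    by apply: integrableZl => //; exact: integrableD.
  by apply/funext => u /=; rewrite kE.
have <- : \int[mu]_u k u = \int[mu]_u h u.
  under eq_Rintegral do rewrite kE.
  rewrite RintegralZl// RintegralD//.
  by rewrite [X in _ + X]/Rintegral integral_reflect// -/(Rintegral mu setT h); field.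
have kN : k =1 k \o -%R.
  by move=> u; rewrite /= !kE opprK addrC.
have ik0 : mu.-integrable `]0, +oo[ (EFin \o k) by exact: integrableS ik.
have sE : [set x : R | 0 <= x] = `[0, +oo[%classic.
  by apply/seteqP; split => x /=; rewrite in_itv/= andbT.
rewrite /Rintegral (ge0_symfun_integralT k0 ck kN) sE fineM//; last first.
  by apply: integrable_fin_num => //; exact: integrableS ik.
by congr (_ * _); rewrite /besselK Rintegral_itv_obnd_cbnd.
Qed.

End gamma_bessel.

(** * Theta series and their Mellin transforms *)

Section theta.
Context {R : realType}.
Notation mu := (@lebesgue_measure R).
Variable c : R.
Hypothesis c0 : 0 < c.
Implicit Types (u z : R).

(** The trace series of the heat semigroup on a circle, at time [t = exp u]. *)
Definition theta N u z : R :=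
  zsum N (fun k => expR (- (c * expR u * k%:~R ^+ 2)) * cos (2 * k%:~R * (pi * z))).

(** The Poisson dual of [theta]: the heat kernel on the line, up to a factor, summed
    over the lattice. *)
Definition dual_theta N u z : R :=
  zsum N (fun n => expR (- (pi ^+ 2 / c * expR (- u) * (z + n%:~R) ^+ 2))).

(** The factor [sqrt (c t / pi)], for [t = exp u], that Poisson summation puts
    between [theta] and [dual_theta]. *)
Definition theta_factor u : R := Num.sqrt (c / pi) * expR (u / 2).

Lemma theta_factor_gt0 u : 0 < theta_factor u.
Proof. by rewrite mulr_gt0 ?expR_gt0// sqrtr_gt0 divr_gt0// pi_gt0. Qed.

Lemma dual_theta_ge0 N u z : 0 <= dual_theta N u z.
Proof. by apply: zsum_ge0 => n; exact: expR_ge0. Qed.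

Lemma poisson_theta u z : exists S : R, dual_theta N u z @[N --> \oo] --> S /\
  theta_factor u * theta N u z @[N --> \oo] --> S.
Proof.
have p0 := pi_gt0 R; set a := pi ^+ 2 / c * expR (- u).
have a0 : 0 < a by rewrite mulr_gt0 ?expR_gt0// divr_gt0// exprn_gt0.
have [S [h1 h2]] := poisson_gauss z a0; exists S; split; first exact: h1.
have e1 : pi ^+ 2 / a = c * expR u.
  rewrite /a expRN; move: (gt_eqF p0); generalize (pi : R) => p hp; field.
  by rewrite (gt_eqF (expR_gt0 u)) (gt_eqF c0) hp.
have e2 : Num.sqrt (pi / a) = theta_factor u.
  rewrite /theta_factor -[expR (u / 2)]ger0_norm ?expR_ge0// -sqrtr_sqr -sqrtrM.
    congr Num.sqrt; rewrite -expRM_natl (_ : 2%:R * (u / 2) = u); last by field.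
    rewrite /a expRN; move: (gt_eqF p0); generalize (pi : R) => p hp; field.
    by rewrite (gt_eqF (expR_gt0 u)) (gt_eqF c0) hp.
  by apply: divr_ge0; exact: ltW.
by rewrite e1 e2 in h2.
Qed.

Lemma norm_theta_le N u z : `|theta N u z| <= theta N u 0.
Proof.
rewrite (le_trans (norm_zsum _ _))//; apply: le_zsum => k.
rewrite !mulr0 cos0 mulr1 (le_trans (norm_mul_cos _ _))// ger0_norm// expR_ge0.
Qed.

Lemma theta0E N u : theta N u 0 = zsum N (fun k => expR (- (c * expR u * k%:~R ^+ 2))).
Proof. by apply: eq_bigr => i _; rewrite !mulr0 cos0 mulr1. Qed.

(** For [u >= 0] the sum is at most its value at [u = 0]; for [u <= 0] the dual sum
    is at most its value at [u = 0], and Poisson's formula transfers this bound. *)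
Lemma theta_bound : exists2 K : R, 0 <= K &
  forall N u z, theta_factor u * `|theta N u z| <= K * (1 + expR u).
Proof.
have p0 := pi_gt0 R; have b0 : 0 < pi ^+ 2 / c by rewrite divr_gt0// exprn_gt0.
have [K1 hK1] := gauss_zsum_bounded 0 c0.
have [K2 hK2] := gauss_zsum_bounded 0 b0.
have K10 : 0 <= K1 by apply: le_trans (hK1 0%N); apply: zsum_ge0 => k; exact: expR_ge0.
have K20 : 0 <= K2 by apply: le_trans (hK2 0%N); apply: zsum_ge0 => k; exact: expR_ge0.
set q := Num.sqrt (c / pi); have q0 : 0 <= q by exact: sqrtr_ge0.
exists (q * K1 + K2) => [|N u z]; first by rewrite addr_ge0 ?mulr_ge0.
have e0 := expR_gt0 u.
apply: (@le_trans _ _ (theta_factor u * theta N u 0)).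
  by rewrite ler_pM2l ?theta_factor_gt0// norm_theta_le.
have [u0|u0] := leP 0 u.
  have hu : expR (u / 2) <= 1 + expR u.
    have : expR (u / 2) <= expR u by rewrite ler_expR; lra.
    lra.
  have ht : theta N u 0 <= K1.
    rewrite theta0E; apply: le_trans (hK1 N); apply: le_zsum => k.
    rewrite add0r ler_expR lerN2 ler_wpM2r ?sqr_ge0// ler_peMr ?(ltW c0)//.
    by rewrite -expR0 ler_expR.
  apply: (@le_trans _ _ (q * K1 * (1 + expR u))).
    rewrite /theta_factor -/q -!mulrA ler_wpM2l// [leRHS]mulrC ler_pM ?expR_ge0//.
    by rewrite theta0E; apply: zsum_ge0 => k; exact: expR_ge0.
  by rewrite ler_wpM2r ?addr_ge0 ?(ltW e0)// lerDl.
have [S [h1 h2]] := poisson_theta u 0.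
have S2 : S <= K2.
  apply: (cvgr_to_le h1); apply: nearW => n; apply: le_trans (hK2 n).
  apply: le_zsum => k; rewrite ler_expR lerN2 ler_wpM2r ?sqr_ge0//.
  by rewrite ler_peMr ?(ltW b0)// -expR0 ler_expR oppr_ge0 ltW.
have tS : theta_factor u * theta N u 0 <= S.
  have mono : nondecreasing_seq (fun n => theta_factor u * theta n u 0).
    apply/nondecreasing_seqP => n; rewrite ler_pM2l ?theta_factor_gt0//.
    by rewrite !theta0E zsumS lerDl addr_ge0 ?expR_ge0.
  have <- : limn (fun n => theta_factor u * theta n u 0) = S by exact/cvg_lim.
  by apply: nondecreasing_cvgn_le => //; apply/cvg_ex; exists S.
apply: (le_trans tS); apply: (le_trans S2).
have qK : 0 <= q * K1 by rewrite mulr_ge0.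
rewrite -[leLHS]mulr1; apply: ler_pM => //; lra.
Qed.

Lemma cvg_prod_ord (d : nat) (f : 'I_d -> nat -> R) (l : 'I_d -> R) :
  (forall i, f i n @[n --> \oo] --> l i) ->
  \prod_i f i n @[n --> \oo] --> \prod_i l i.
Proof.
move=> h; elim: (index_enum _) => [|j r IH].
  by rewrite big_nil; under eq_fun do rewrite big_nil; exact: cvg_cst.
by rewrite big_cons; under eq_fun do rewrite big_cons; apply: cvgM.
Qed.

Lemma measurable_theta N z : measurable_fun setT (theta N ^~ z).
Proof.
apply: measurable_sum => i; apply: continuous_measurable_fun => u.
by apply/differentiable_continuous/derivable1_diffP.
Qed.

Lemma measurable_dual_theta N z : measurable_fun setT (dual_theta N ^~ z).
Proof.
apply: measurable_sum => i; apply: continuous_measurable_fun => u.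
by apply/differentiable_continuous/derivable1_diffP.
Qed.

(** Both products over the coordinates, once multiplied by the weight
    [gamma_kernel nu 1], are dominated by a multiple of [gamma_kernel nu (1 / 2)]
    and have the same pointwise limit. *)
Lemma theta_integral_cvg (d : nat) (nu : R) (z : 'I_d -> R) : (0 < d)%N -> 0 < nu ->
  exists J : R,
    \int[mu]_u (gamma_kernel nu 1 u * \prod_i (theta_factor u * theta N u (z i)))
      @[N --> \oo] --> J /\
    \int[mu]_u (gamma_kernel nu 1 u * \prod_i dual_theta N u (z i)) @[N --> \oo] --> J.
Proof.
move=> d0 nu0; have [K K0 hK] := theta_bound.
pose S u i := limn (fun N => dual_theta N u (z i)).
have dS u i : dual_theta N u (z i) @[N --> \oo] --> S u i.
  by have [S' [h _]] := poisson_theta u (z i); apply/cvg_ex; exists S'.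
have tS u i : theta_factor u * theta N u (z i) @[N --> \oo] --> S u i.
  have [S' [h h']] := poisson_theta u (z i).
  by rewrite (_ : S u i = S') //; apply/cvg_lim.
have SK u i : S u i <= K * (1 + expR u).
  apply: (cvgr_to_le (tS u i)); apply: nearW => n.
  by rewrite (le_trans _ (hK n u (z i)))// ler_wpM2l ?ler_norm// ltW ?theta_factor_gt0.
have dmono u i : nondecreasing_seq (fun n => dual_theta n u (z i)).
  by apply/nondecreasing_seqP => n; rewrite /dual_theta zsumS lerDl addr_ge0 ?expR_ge0.
have dK N u i : dual_theta N u (z i) <= K * (1 + expR u).
  apply: le_trans (SK u i); apply: (nondecreasing_cvgn_le (dmono u i)).
  by apply/cvg_ex; exists (S u i).
(* [D] spreads the exponent [exp u / 2] over the [d] factors, so that their product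
   turns the weight [gamma_kernel nu 1] into [gamma_kernel nu (1 / 2)]. *)
pose D : R := 2 * d%:R; have D1 : 1 <= D.
  by rewrite /D -natrM ler1n muln_gt0.
have D0 : 0 < D by lra.
pose M := (K * D) ^+ d.
pose g u := M * gamma_kernel nu 2^-1 u.
have prodK u (f : 'I_d -> R) : (forall i, `|f i| <= K * (1 + expR u)) ->
    `|gamma_kernel nu 1 u * \prod_i f i| <= g u.
  move=> fK; have e0 := expR_gt0 u.
  have step i : `|f i| <= K * D * expR (expR u / D).
    apply: (le_trans (fK i)); rewrite -mulrA ler_wpM2l//.
    apply: (@le_trans _ _ (D * (1 + expR u / D))).
      by rewrite mulrDr mulr1 [D * (_ / _)]mulrC divfK ?gt_eqF// lerD2r.
    by rewrite ler_pM2l// expR_ge1Dx.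
  have h : `|\prod_i f i| <= M * expR (expR u / 2).
    rewrite normr_prod (@le_trans _ _ (\prod_(i < d) (K * D * expR (expR u / D))))//.
      by apply: ler_prod => i _; rewrite normr_ge0 step.
    rewrite prodr_const card_ord exprMn -expRM_natl /M.
    by rewrite (_ : d%:R * (expR u / D) = expR u / 2)// /D; field; rewrite pnatr_eq0 -lt0n.
  rewrite normrM ger0_norm ?expR_ge0// /g.
  have -> : gamma_kernel nu 2^-1 u = gamma_kernel nu 1 u * expR (expR u / 2).
    by rewrite /gamma_kernel -expRD; congr expR; field.
  by rewrite mulrCA ler_wpM2l// expR_ge0.
have ig : mu.-integrable setT (EFin \o g).
  rewrite (_ : EFin \o g = fun u => (M%:E * (gamma_kernel nu 2^-1 u)%:E)%E)//.
  by apply: integrableZl => //; apply: integrable_gamma_kernel => //; lra.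
have mg : measurable_fun setT (gamma_kernel nu (1 : R)).
  by apply: continuous_measurable_fun; exact: continuous_gamma_kernel.
have mF : measurable_fun setT theta_factor.
  apply: continuous_measurable_fun => u.
  by apply/differentiable_continuous/derivable1_diffP; rewrite /theta_factor.
exists (\int[mu]_u (gamma_kernel nu 1 u * \prod_i S u i)).
split; apply: (@Rintegral_dominated_cvg _ setT _ _ g) => //.
- move=> N; apply: measurable_funM => //; apply: measurable_prod => i _.
  by apply: measurable_funM => //; exact: measurable_theta.
- by move=> u _; apply: cvgM; [exact: cvg_cst|exact: cvg_prod_ord].
- move=> N u _; apply: prodK => i; rewrite normrM gtr0_norm ?theta_factor_gt0//.
- move=> N; apply: measurable_funM => //; apply: measurable_prod => i _.
  exact: measurable_dual_theta.
- by move=> u _; apply: cvgM; [exact: cvg_cst|exact: cvg_prod_ord].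
- by move=> N u _; apply: prodK => i; rewrite ger0_norm ?dual_theta_ge0.
Qed.

End theta.

(** * Unconditional sums *)

Section has_usum.
Context {I : choiceType} {K : numFieldType}.
Implicit Types (f g : I -> K) (s : K).
#[local] Existing Instance totally_filter.

Definition has_usum f s : Prop := partial_sum f @ totally --> s.

Lemma partial_sumE (V : zmodType) (f : I -> V) (A : {fset I}) :
  partial_sum f A = \sum_(i <- A) f i.
Proof. by rewrite big_seq_fsetE. Qed.

Lemma has_usumP f s : has_usum f s <->
  forall e, 0 < e -> exists A : {fset I}, forall B : {fset I}, (A `<=` B)%fset ->
    `|s - \sum_(i <- B) f i| < e.
Proof.
split=> [/cvgrPdist_lt h e /h[A _ hA]|h].
  by exists A => B AB; rewrite -partial_sumE; exact: hA.
apply/cvgrPdist_lt => e /h[A hA]; exists A => //= B AB.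
by rewrite partial_sumE; exact: hA.
Qed.

Lemma has_usum_usummable f s : has_usum f s -> usummable f.
Proof. by move=> h; apply/cvg_ex; exists s. Qed.

Lemma has_usum_usum f s : has_usum f s -> usum f = s.
Proof. by move=> h; apply/cvg_lim. Qed.

Lemma has_usum_ext f g s : f =1 g -> has_usum f s -> has_usum g s.
Proof. by move=> /funext ->. Qed.

Lemma has_usumZ f s (c : K) : has_usum f s -> has_usum (fun i => c * f i) (c * s).
Proof.
rewrite /has_usum => h.
rewrite (_ : partial_sum _ = fun A => c * partial_sum f A).
  by apply: cvgM => //; exact: cvg_cst.
by apply/funext => A; rewrite !partial_sumE mulr_sumr.
Qed.

Lemma has_usum_sum (J : finType) (f : J -> I -> K) (s : J -> K) :
  (forall j, has_usum (f j) (s j)) ->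
  has_usum (fun i => \sum_j f j i) (\sum_j s j).
Proof.
rewrite /has_usum => h.
rewrite (_ : partial_sum _ = fun A => \sum_j partial_sum (f j) A).
  elim: (index_enum J) => [|j r IH].
    by rewrite big_nil; under eq_fun do rewrite big_nil; exact: cvg_cst.
  rewrite big_cons; under eq_fun do rewrite big_cons.
  by apply: cvgD => //; exact: h.
apply/funext => A; rewrite partial_sumE exchange_big; apply: eq_bigr => j _.
by rewrite partial_sumE.
Qed.

End has_usum.


(** Regrouping an unconditional sum into disjoint finite blocks that cover the
    support: the finite unions of blocks are cofinal among the finite subsets of
    the support. *)
Lemma has_usum_regroup (I J : choiceType) (K : numFieldType) (f : I -> K)
    (fib : J -> {fset I}) (s : K) :
  (forall i j j', i \in fib j -> i \in fib j' -> j = j') ->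
  (forall i, f i != 0 -> exists j, i \in fib j) ->
  has_usum f s -> has_usum (fun j => \sum_(i <- fib j) f i) s.
Proof.
move=> dfib cov /has_usumP hf; apply/has_usumP => e /hf[A hA].
pose p i : {fset J} := if pselect (exists j, i \in fib j) is left h
  then [fset projT1 (cid h)]%fset else fset0.
exists (\bigcup_(i <- A) p i)%fset => B AB.
rewrite -partition_disjoint_bigfcup; last first.
  move=> j j' _ _ jj'; apply/fdisjointP => i ij; apply/negP => ij'.
  by move/eqP: jj'; apply; exact: dfib ij ij'.
set X := (\bigcup_(j <- B) fib j)%fset.
rewrite (@big_fset_incl _ _ _ _ X (X `|` A)%fset) ?fsubsetUl//; last first.
  move=> i; rewrite in_fsetU => /orP[-> //|iA iX].
  apply: contraNeq iX => /cov ex; apply/bigfcupP.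
  have ip : i \in fib (projT1 (cid ex)) by case: (cid ex).
  exists (projT1 (cid ex)) => //; rewrite andbT.
  apply: (fsubsetP AB); apply/bigfcupP; exists i; first by rewrite iA.
  by rewrite /p; case: pselect => // ex'; rewrite in_fset1 (Prop_irrelevance ex ex').
by apply: hA; exact: fsubsetUr.
Qed.

(** A real family with bounded absolute partial sums along an increasing
    exhaustion is unconditionally summable, to the limit along that exhaustion. *)
Lemma has_usum_exhaust (I : choiceType) (R : realType) (f : I -> R)
    (B : nat -> {fset I}) (M s : R) :
  (forall m n, (m <= n)%N -> (B m `<=` B n)%fset) ->
  (forall i, exists n, i \in B n) ->
  (forall n, \sum_(i <- B n) `|f i| <= M) ->
  \sum_(i <- B n) f i @[n --> \oo] --> s -> has_usum f s.
Proof.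
move=> Bm Bx fM fs; apply/has_usumP => e e0.
pose g n := \sum_(i <- B n) `|f i|.
have sumD (X Y : {fset I}) (h : I -> R) : (X `<=` Y)%fset ->
    \sum_(i <- Y) h i = \sum_(i <- X) h i + \sum_(i <- (Y `\` X)%fset) h i.
  move=> XY; rewrite (big_fsetID _ (mem X)) /=; congr (_ + _).
    apply: eq_fbigl => i; rewrite !inE /=.
    by case: (boolP (i \in X)) => [/(fsubsetP XY)->|]; rewrite ?andbF.
  by apply: eq_fbigl => i; rewrite !inE /= andbC.
have gm : {homo g : m n / (m <= n)%N >-> m <= n}.
  by move=> m n /Bm mn; rewrite /g (sumD _ _ _ mn) lerDl sumr_ge0.
have gc : cvg (g @ \oo).
  by apply: nondecreasing_is_cvgn => //; exists M => _ [n _ <-]; exact: fM.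
have e2 : 0 < e / 2 by rewrite divr_gt0.
have [n0 [gn0 fn0]] : exists n0, limn g - g n0 < e / 2 /\ `|s - \sum_(i <- B n0) f i| < e / 2.
  have h1 : \forall n \near \oo, `|limn g - g n| < e / 2 by move/cvgrPdist_lt : gc; exact.
  have h2 : \forall n \near \oo, `|s - \sum_(i <- B n) f i| < e / 2.
    by move/cvgrPdist_lt : fs; exact.
  have [n _ hn] := filterI h1 h2; exists n.
  have [h3 h4] := hn n (leqnn n); split => //.
  exact: le_lt_trans (ler_norm _) h3.
exists (B n0) => X BX.
have [n1 n01 XB] : exists2 n1, (n0 <= n1)%N & (X `<=` B n1)%fset.
  pose N i := projT1 (cid (Bx i)).
  exists (n0 + \sum_(i <- X) N i)%N; first exact: leq_addr.
  apply/fsubsetP => i iX; have iN : i \in B (N i) by rewrite /N; case: (cid (Bx i)).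
  apply: (fsubsetP (Bm (N i) _ _)) iN.
  by rewrite (big_fsetD1 i iX) /=; lia.
rewrite (sumD _ _ _ BX) opprD addrA (splitr e).
rewrite (le_lt_trans (ler_normB _ _))// ltrD//.
rewrite (le_lt_trans (ler_norm_sum _ _ _))// (le_lt_trans _ gn0)//.
rewrite lerBrDl -(sumD _ _ (fun i => `|f i|) BX).
apply: (@le_trans _ _ (g n1)); last exact: nondecreasing_cvgn_le.
by rewrite /g (sumD _ _ _ XB) lerDl sumr_ge0.
Qed.

(** Convergence in [R[i]] is convergence of the real and imaginary parts. *)
Lemma has_usum_complex (I : choiceType) (R : realType) (f g : I -> R) (a b : R) :
  has_usum f a -> has_usum g b ->
  has_usum (fun i => f i +i* g i) (a +i* b).
Proof.
move=> /has_usumP hf /has_usumP hg; apply/has_usumP => e.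
rewrite ltcE /= => /andP[/eqP e_im e0].
have e2 : 0 < complex.Re e / 2 by rewrite divr_gt0.
have [A hA] := hf _ e2; have [B hB] := hg _ e2.
exists (A `|` B)%fset => X; rewrite fsubUset => /andP[/hA h1 /hB h2].
have -> : \sum_(i <- X) (f i +i* g i) = (\sum_(i <- X) f i) +i* (\sum_(i <- X) g i).
  elim: (enum_fset X) => [|x r IH]; first by rewrite !big_nil.
  by rewrite !big_cons IH.
set u := a - \sum_(i <- X) f i in h1; set v := b - \sum_(i <- X) g i in h2.
have -> : (a +i* b) - ((\sum_(i <- X) f i) +i* (\sum_(i <- X) g i)) = (u +i* 0) + (0 +i* v) :> R[i].
  by apply/eqP; rewrite eq_complex /= addr0 add0r !eqxx.
have -> : e = (complex.Re e)%:C by apply/eqP; rewrite eq_complex /= e_im !eqxx.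
apply: le_lt_trans (ler_normD _ _) _.
rewrite !normc_def /= expr0n /= addr0 add0r !sqrtr_sqr -rmorphD /= ltcR.
by rewrite (splitr (complex.Re e)) ltrD.
Qed.

(** * Sums over boxes of multi-indices *)

Lemma sum_rV_prod (K : comPzRingType) (T : finType) (d : nat) (P : 'I_d -> pred T)
    (F : 'I_d -> T -> K) :
  \sum_(M : 'rV[T]_d | [forall i, P i (M ord0 i)]) \prod_i F i (M ord0 i) =
  \prod_i \sum_(j | P i j) F i j.
Proof.
rewrite (bigA_distr_big_dep (fun i j => P i j)) /=.
rewrite (reindex (fun f : {ffun 'I_d -> T} => \row_i f i)) /=.
  apply: eq_big => [f|f _].
    by apply: eq_forallb => i; rewrite mxE.
  by apply: eq_bigr => i _; rewrite mxE.
apply: onW_bij; exists (fun M : 'rV[T]_d => [ffun i => M ord0 i]) => [f|M].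
  by apply/ffunP => i; rewrite ffunE mxE.
by apply/rowP => i; rewrite mxE ffunE.
Qed.

Section box.
Variable d : nat.

Definition box_point N (M : 'rV['I_N.*2.+1]_d) : 'rV[int]_d :=
  \row_i ((M ord0 i : nat)%:Z - N%:Z).

Definition box N : {fset 'rV[int]_d} :=
  [fset box_point M | M in {: 'rV['I_N.*2.+1]_d}]%fset.

Lemma box_point_inj N : injective (@box_point N).
Proof.
move=> M M' /rowP h; apply/rowP => i; apply/val_inj.
by have := h i; rewrite !mxE; change (val (M 0 i)) with (nat_of_ord (M ord0 i)); change (val (M' 0 i)) with (nat_of_ord (M' ord0 i)); lia.
Qed.

Lemma in_box N (k : 'rV[int]_d) : (k \in box N) = [forall i, (`|k ord0 i| <= N)%N].
Proof.
apply/imfsetP/forallP => [[M _ ->] i|h].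
  by rewrite mxE; case: (M ord0 i) => m /= hm; lia.
have kN i : (absz (k ord0 i + N%:Z)%R < N.*2.+1)%N by have := h i; lia.
exists (\row_i Ordinal (kN i)) => //.
by apply/rowP => i; have := h i; rewrite !mxE /= -[ord0]/(0 : 'I_1); lia.
Qed.

Lemma sum_box (K : zmodType) N (F : 'rV[int]_d -> K) :
  \sum_(k <- box N) F k = \sum_(M : 'rV['I_N.*2.+1]_d) F (box_point M).
Proof.
rewrite /box big_imfset /=; last by move=> M M' _ _; exact: box_point_inj.
rewrite -[RHS]big_enum; apply: perm_big; apply: uniq_perm; rewrite ?enum_uniq ?enum_finmem_uniq//.
Qed.

Lemma sum_box_prod (K : comPzRingType) N (F : 'I_d -> int -> K) :
  \sum_(k <- box N) \prod_i F i (k ord0 i) = \prod_i zsum N (F i).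
Proof.
rewrite sum_box /zsum -(sum_rV_prod (fun _ => predT)).
apply: eq_big => [M|M _]; first by apply/esym/forallP.
by apply: eq_bigr => i _; rewrite mxE.
Qed.

Lemma box_mono m n : (m <= n)%N -> (box m `<=` box n)%fset.
Proof.
move=> mn; apply/fsubsetP => k; rewrite !in_box => /forallP h.
by apply/forallP => i; have := h i; lia.
Qed.

Lemma box_cover (k : 'rV[int]_d) : exists n, k \in box n.
Proof.
exists (\sum_i `|k ord0 i|%N)%N; rewrite in_box; apply/forallP => i.
by rewrite (bigD1 i) //=; lia.
Qed.

End box.

(** * The spectral series and the lattice series *)

Lemma cvgn_norm_le (R : realType) (v : nat -> R) (l : R) :
  v n @[n --> \oo] --> l -> exists M, forall n, `|v n| <= M.
Proof.
move=> /cvgP /cvg_seq_bounded [M [_ hM]]; exists (M + 1) => n.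
by apply: (hM (M + 1)); rewrite ?ltrDl.
Qed.

Section expi.
Context {R : realType}.
Implicit Types s t : R.

Lemma expi0 : expi (0 : R) = 1.
Proof. by rewrite /expi cos0 sin0. Qed.

Lemma expiD s t : expi (s + t) = expi s * expi t.
Proof.
rewrite /expi cosD sinD; apply/eqP; rewrite eq_complex /=.
by apply/andP; split; apply/eqP; ring.
Qed.

Lemma expi_sum (I : finType) (f : I -> R) : expi (\sum_i f i) = \prod_i expi (f i).
Proof. exact: (big_morph _ expiD expi0). Qed.

Lemma zsum_even_expi (w : int -> R) t N : (forall k, w (- k) = w k) ->
  zsum N (fun k => (w k)%:C * expi (k%:~R * t)) =
  (zsum N (fun k => w k * cos (k%:~R * t)))%:C.
Proof.
move=> wN; elim: N => [|N IH]; first by rewrite !zsum0 mul0r expi0 cos0 rmorphM.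
rewrite !zsumS IH rmorphD /=; congr (_ + _).
rewrite !wN !mulrNz !mulNr cosN /expi cosN sinN.
by apply/eqP; rewrite eq_complex /=; apply/andP; split; apply/eqP; ring.
Qed.

End expi.

Section box_sums.
Context {R : realType}.
Notation mu := (@lebesgue_measure R).
Variables (d : nat) (c nu : R).
Hypotheses (d0 : (0 < d)%N) (c0 : 0 < c) (nu0 : 0 < nu).
Implicit Types (k : 'rV[int]_d) (z : 'rV[R]_d) (u : R).

Definition freq k z : R := 2 * pi * dotp (intvec R k) z.

(** The eigenvalue of the periodic operator to the power [- alpha]. *)
Definition resolvent k : R := (1 + c * sqnorm2 (intvec R k)) `^ (- alpha d nu).

Definition heat u k : R := expR (- (c * expR u * sqnorm2 (intvec R k))).

Lemma alpha_gt0 : 0 < alpha d nu.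
Proof. by rewrite ltr_wpDr// divr_ge0. Qed.

Lemma sqnorm2_ge0 (x : 'rV[R]_d) : 0 <= sqnorm2 x.
Proof. by apply: sumr_ge0 => i _; exact: sqr_ge0. Qed.

Lemma eigenvalue_gt0 k : 0 < 1 + c * sqnorm2 (intvec R k).
Proof. by rewrite ltr_wpDr// mulr_ge0 ?sqnorm2_ge0// ltW. Qed.

Lemma expR_sqnorm2 (q : R) (x : 'rV[R]_d) :
  expR (- (q * sqnorm2 x)) = \prod_i expR (- (q * x ord0 i ^+ 2)).
Proof. by rewrite -expR_sum sumrN -mulr_sumr. Qed.

(** The sum over a box of the complex exponentials factors over the coordinates; in
    each factor the sine part cancels between [k] and [- k]. *)
Lemma heat_box_sums N u z :
  \sum_(k <- box d N) heat u k * cos (freq k z) = \prod_i theta c N u (z ord0 i) /\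
  \sum_(k <- box d N) heat u k * sin (freq k z) = 0.
Proof.
pose F (i : 'I_d) (m : int) : R[i] :=
  (expR (- (c * expR u * m%:~R ^+ 2)))%:C * expi (m%:~R * (2 * pi * z ord0 i)).
have e1 : \sum_(k <- box d N) \prod_i F i (k ord0 i) = (\prod_i theta c N u (z ord0 i))%:C.
  rewrite sum_box_prod rmorph_prod; apply: eq_bigr => i _.
  rewrite /F zsum_even_expi; last by move=> m; rewrite mulrNz sqrrN.
  congr (_%:C); apply: eq_bigr => j _; congr (_ * cos _); ring.
have e2 k : \prod_i F i (k ord0 i) =
    (heat u k * cos (freq k z)) +i* (heat u k * sin (freq k z)).
  rewrite /F big_split /= -rmorph_prod -expi_sum.
  rewrite /heat expR_sqnorm2.
  have -> : \prod_i expR (- (c * expR u * (k ord0 i)%:~R ^+ 2)) =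
    \prod_i expR (- (c * expR u * (intvec R k) ord0 i ^+ 2)).
    by apply: eq_bigr => i _; rewrite mxE.
  have -> : \sum_i (k ord0 i)%:~R * (2 * pi * z ord0 i) = freq k z.
    rewrite /freq /dotp mulr_sumr; apply: eq_bigr => i _; rewrite mxE; ring.
  by apply/eqP; rewrite /expi eq_complex /=; apply/andP; split; apply/eqP; ring.
have e3 : \sum_(k <- box d N) \prod_i F i (k ord0 i) =
  (\sum_(k <- box d N) heat u k * cos (freq k z)) +i*
  (\sum_(k <- box d N) heat u k * sin (freq k z)).
  under eq_bigr do rewrite e2.
  by elim: (enum_fset _) => [|x r IH]; rewrite ?big_nil// !big_cons IH.
by move: e3; rewrite e1 => -[-> <-].
Qed.

(** The eigenvalue in the exponent is split into the factor [exp (- t)], part of the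
    weight, and the heat semigroup at time [t = exp u]. *)
Lemma gamma_kernel_heat u k :
  gamma_kernel (alpha d nu) 1 u * heat u k =
  gamma_kernel (alpha d nu) (1 + c * sqnorm2 (intvec R k)) u.
Proof. by rewrite /gamma_kernel /heat -expRD; congr expR; ring. Qed.

(** [Gamma alpha * lambda ^ (- alpha)] is the integral of
    [gamma_kernel alpha lambda]; the sum is finite, so it may be exchanged with the
    integral. *)
Lemma resolvent_box_sum N (tau : 'rV[int]_d -> R) :
  Gamma (alpha d nu) * \sum_(k <- box d N) resolvent k * tau k =
  \int[mu]_u (gamma_kernel (alpha d nu) 1 u *
    \sum_(k <- box d N) heat u k * tau k).
Proof.
have ig k : mu.-integrable setT (EFin \o gamma_kernel (alpha d nu) (1 + c * sqnorm2 (intvec R k))).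
  by apply: integrable_gamma_kernel; [exact: alpha_gt0|exact: eigenvalue_gt0].
have igt k : mu.-integrable setT (EFin \o (fun u =>
    tau k * gamma_kernel (alpha d nu) (1 + c * sqnorm2 (intvec R k)) u)).
  rewrite (_ : EFin \o _ = fun u => ((tau k)%:E *
    (gamma_kernel (alpha d nu) (1 + c * sqnorm2 (intvec R k)) u)%:E)%E)//.
  by apply: integrableZl => //; exact: ig.
have -> : \int[mu]_u (gamma_kernel (alpha d nu) 1 u * \sum_(k <- box d N) heat u k * tau k) =
  \int[mu]_u (\sum_(k <- box d N)
    tau k * gamma_kernel (alpha d nu) (1 + c * sqnorm2 (intvec R k)) u).
  apply: eq_Rintegral => u _; rewrite mulr_sumr; apply: eq_bigr => k _.
  by rewrite -gamma_kernel_heat; ring.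
have /= -> := Rintegral_sum (box d N) measurableT igt.
rewrite mulr_sumr; apply: eq_bigr => k _.
rewrite RintegralZl// Rintegral_gamma_kernel ?alpha_gt0 ?eigenvalue_gt0// /resolvent; ring.
Qed.

(** The [d] factors [exp (u / 2)] of Poisson's formula account for the difference
    [alpha - nu = d / 2] between the two weights. *)
Lemma theta_factor_prod N u z :
  gamma_kernel nu 1 u * \prod_i (theta_factor c u * theta c N u (z ord0 i)) =
  Num.sqrt (c / pi) ^+ d * (gamma_kernel (alpha d nu) 1 u * \prod_i theta c N u (z ord0 i)).
Proof.
rewrite big_split /= prodr_const card_ord /theta_factor exprMn -expRM_natl.
rewrite mulrA mulrCA -!mulrA; congr (_ * _); rewrite !mulrA; congr (_ * _).
by rewrite /gamma_kernel -expRD; congr expR; rewrite /alpha; field.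
Qed.

(** Up to a constant the Matern function, by [Rintegral_bessel_kernel]. *)
Definition matern_integral z : R :=
  \int[mu]_u bessel_kernel nu (pi ^+ 2 / c * sqnorm2 z) u.

Lemma dual_ge0 z : 0 <= pi ^+ 2 / c * sqnorm2 z.
Proof. by rewrite mulr_ge0 ?sqnorm2_ge0// divr_ge0 ?sqr_ge0// ltW. Qed.

Lemma matern_box_sum N z :
  \sum_(n <- box d N) matern_integral (z + intvec R n) =
  \int[mu]_u (gamma_kernel nu 1 u * \prod_i dual_theta c N u (z ord0 i)).
Proof.
have ib n := integrable_bessel_kernel nu0 (dual_ge0 (z + intvec R n)).
have /= <- := Rintegral_sum (box d N) measurableT ib.
apply: eq_Rintegral => u _.
rewrite /dual_theta -(sum_box_prod N (fun i m => expR (- (pi ^+ 2 / c * expR (- u) * (z ord0 i + m%:~R) ^+ 2)))).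
rewrite mulr_sumr; apply: eq_bigr => n _.
have -> : \prod_i expR (- (pi ^+ 2 / c * expR (- u) * (z ord0 i + (n ord0 i)%:~R) ^+ 2)) =
    expR (- (pi ^+ 2 / c * expR (- u) * sqnorm2 (z + intvec R n))).
  by rewrite expR_sqnorm2; apply: eq_bigr => i _; rewrite !mxE.
by rewrite /gamma_kernel /bessel_kernel -expRD; congr expR; ring.
Qed.

(** The finite box sums of both series are the two integrals of
    [theta_integral_cvg], hence have a common limit up to the constant. Absolute
    convergence, needed for the passage to unconditional sums, comes from the case
    [z = 0] for the spectral series and from positivity for the lattice series. *)
Theorem has_usum_resolvent_matern z : exists J : R,
  [/\ has_usum (fun k => resolvent k * cos (freq k z))
        (J / (Num.sqrt (c / pi) ^+ d * Gamma (alpha d nu))),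
      has_usum (fun k => resolvent k * sin (freq k z)) 0 &
      has_usum (fun n => matern_integral (z + intvec R n)) J].
Proof.
have r0 k : 0 <= resolvent k by exact: powR_ge0.
have g0 : 0 < Gamma (alpha d nu) by apply: Gamma_gt0; exact: alpha_gt0.
have q0 : 0 < Num.sqrt (c / pi) ^+ d.
  by rewrite exprn_gt0// sqrtr_gt0 divr_gt0// pi_gt0.
have it N z' : mu.-integrable setT (EFin \o (fun u =>
    gamma_kernel (alpha d nu) 1 u * \prod_i theta c N u (z' ord0 i))).
  have ig k : mu.-integrable setT (EFin \o (fun u => cos (freq k z') *
      gamma_kernel (alpha d nu) (1 + c * sqnorm2 (intvec R k)) u)).
    rewrite (_ : EFin \o _ = fun u => ((cos (freq k z'))%:E *
      (gamma_kernel (alpha d nu) (1 + c * sqnorm2 (intvec R k)) u)%:E)%E)//.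
    apply: integrableZl => //.
    by apply: integrable_gamma_kernel; [exact: alpha_gt0|exact: eigenvalue_gt0].
  rewrite (_ : EFin \o _ = fun u => (\sum_(k <- box d N) (cos (freq k z') *
      gamma_kernel (alpha d nu) (1 + c * sqnorm2 (intvec R k)) u)%:E)%E).
    by apply: (@integrable_sum _ _ _ mu setT) => // k _; exact: ig.
  apply/funext => u; rewrite sumEFin /=; congr EFin.
  rewrite -(heat_box_sums N u z').1 mulr_sumr; apply: eq_bigr => k _.
  by rewrite -gamma_kernel_heat; ring.
have cosE N z' : \sum_(k <- box d N) resolvent k * cos (freq k z') =
    \int[mu]_u (gamma_kernel nu 1 u * \prod_i (theta_factor c u * theta c N u (z' ord0 i)))
    / (Num.sqrt (c / pi) ^+ d * Gamma (alpha d nu)).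
  under eq_Rintegral do rewrite theta_factor_prod.
  rewrite RintegralZl//.
  under eq_Rintegral do rewrite -(heat_box_sums _ _ _).1.
  by rewrite -resolvent_box_sum; field; rewrite !gt_eqF.
have cvgE z' (J : R) : \int[mu]_u (gamma_kernel nu 1 u * \prod_i (theta_factor c u * theta c N u (z' ord0 i)))
      @[N --> \oo] --> J ->
    \sum_(k <- box d N) resolvent k * cos (freq k z') @[N --> \oo] -->
    J / (Num.sqrt (c / pi) ^+ d * Gamma (alpha d nu)).
  by move=> h; under eq_fun do rewrite cosE; apply: cvgM => //; exact: cvg_cst.
have [M hM] : exists M, forall N, \sum_(k <- box d N) resolvent k <= M.
  have [J [/(cvgE 0) h _]] := theta_integral_cvg c0 (fun i => (0 : 'rV[R]_d) ord0 i) d0 nu0.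
  have [M hM] := cvgn_norm_le h; exists M => N.
  apply: le_trans (le_trans (ler_norm _) (hM N)).
  rewrite le_eqVlt; apply/orP; left; apply/eqP/eq_bigr => k _.
  rewrite /freq /dotp big1 ?mulr0 ?cos0 ?mulr1// => i _.
  by rewrite !mxE mulr0.
have bM (tau : 'rV[int]_d -> R) : (forall k, `|tau k| <= 1) -> forall N,
    \sum_(k <- box d N) `|resolvent k * tau k| <= M.
  move=> t1 N; apply: le_trans (hM N); apply: ler_sum => k _.
  by rewrite normrM ger0_norm// ler_piMr.
have [J [h1 h2]] := theta_integral_cvg c0 (fun i => z ord0 i) d0 nu0.
exists J; split.
- apply: (has_usum_exhaust (@box_mono d) (@box_cover d) (bM _ (fun k => cos_max _))).
  exact: cvgE h1.
- apply: (has_usum_exhaust (@box_mono d) (@box_cover d) (bM _ (fun k => sin_max _))).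
  have e N : \sum_(k <- box d N) resolvent k * sin (freq k z) = 0.
    apply: (mulfI (lt0r_neq0 g0)); rewrite mulr0 resolvent_box_sum.
    under eq_Rintegral do rewrite (heat_box_sums _ _ _).2 mulr0.
    by rewrite Rintegral_cst// mul0r.
  by under eq_fun do rewrite e; exact: cvg_cst.
- have m0 x : 0 <= matern_integral x.
    by apply: Rintegral_ge0 => u _; exact: expR_ge0.
  have h : \sum_(n <- box d N) matern_integral (z + intvec R n) @[N --> \oo] --> J.
    by under eq_fun do rewrite matern_box_sum.
  have [B hB] := cvgn_norm_le h.
  apply: (has_usum_exhaust (@box_mono d) (@box_cover d) _ h) => N.
  apply: le_trans (le_trans (ler_norm _) (hB N)).
  by apply: ler_sum => n _; rewrite ger0_norm.
Qed.

End box_sums.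

(** * The periodic covariance *)

Section periodic.
Context {R : realType}.
Variables (d : nat) (sigma nu rho : R).
Hypotheses (d0 : (0 < d)%N) (nu0 : 0 < nu) (rho0 : 0 < rho).
Implicit Types (x y : 'rV[R]_d) (L : R).

Let kap := kappa nu rho.

Lemma kappa_gt0 : 0 < kap.
Proof. by rewrite divr_gt0// sqrtr_gt0 mulr_gt0. Qed.

(** The factor of [|k|^2] in the eigenvalues of the periodic problem. *)
Definition laplace_coef L : R := (2 * pi / (kap * L)) ^+ 2.

Lemma laplace_coef_gt0 L : 0 < L -> 0 < laplace_coef L.
Proof.
have k0 := kappa_gt0; have p0 := pi_gt0 R; by move=> L0; rewrite exprn_gt0// divr_gt0// mulr_gt0.
Qed.

(** A product of an exponential at [x] and a conjugate one at [y] depends on [x - y]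
    only. *)
Lemma termPE L x y (k : 'rV[int]_d) : 0 < L ->
  termP nu rho L x y k =
  (L ^- d * resolvent (laplace_coef L) nu k)%:C * expi (freq k (L^-1 *: (x - y))).
Proof.
move=> L0; set t := freq _ _.
have -> : t = 2 * pi / L * dotp (intvec R k) x - 2 * pi / L * dotp (intvec R k) y.
  rewrite /t /freq /dotp -mulrBr -sumrB !mulr_sumr; apply: eq_bigr => i _.
  by rewrite !mxE; ring.
have e : L ^- d = L `^ (- (d%:R / 2)) * L `^ (- (d%:R / 2)).
  rewrite -powRD ?(gt_eqF L0) ?implybT//.
  by rewrite (_ : _ + _ = - d%:R); [rewrite powR_invn// ltW|field].
rewrite e /termP /green_term /wP -[resolvent _ _ _]/(lamP kap L k `^ (- alpha d nu)).
set r := _ `^ (- alpha d nu); set a := L `^ _; set s1 := _ * dotp _ x; set s2 := _ * dotp _ y.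
rewrite /expi cosB sinB; apply/eqP; rewrite eq_complex /=.
by apply/andP; split; apply/eqP; ring.
Qed.

(** The argument [r] of the Bessel function satisfies
    [r ^ 2 / 4 = pi ^ 2 / c * |w| ^ 2] for the rescaled vector [w]; at [r = 0] the
    integral is [Gamma nu], which matches the value [1] of [matern_fun]. *)
Lemma matern_covE L x y (n : 'rV[int]_d) : 0 < L ->
  matern_cov sigma nu rho (x + L *: intvec R n) y =
  sigma ^+ 2 / Gamma nu *
    matern_integral (laplace_coef L) nu (L^-1 *: (x - y) + intvec R n).
Proof.
move=> L0; have k0 := kappa_gt0; have p0 := pi_gt0 R; have g0 := Gamma_gt0 nu0.
rewrite /matern_cov -/kap -mulrA; congr (_ * _).
set v := x + L *: intvec R n - y; set w := _ + _.
have vE : v = L *: w.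
  rewrite /v /w scalerDr scalerA divff ?scale1r ?gt_eqF//.
  by rewrite addrAC.
have nE : norm2 v ^+ 2 = L ^+ 2 * sqnorm2 w.
  rewrite /norm2 sqr_sqrtr ?sqnorm2_ge0// vE /sqnorm2 mulr_sumr.
  by apply: eq_bigr => i _; rewrite mxE exprMn.
have qE : pi ^+ 2 / laplace_coef L * sqnorm2 w = (kap * norm2 v) ^+ 2 / 4.
  rewrite exprMn nE /laplace_coef; move: (gt_eqF p0); generalize (pi : R) => p hp.
  by field; rewrite hp !gt_eqF.
rewrite /matern_integral qE /matern_fun.
have [->|r0] := eqVneq (kap * norm2 v) 0.
  rewrite expr0n mul0r.
  rewrite (_ : \int[_]_u _ = Gamma nu); first by rewrite mulVf ?gt_eqF.
  rewrite (Gamma_expR nu0); apply: eq_Rintegral => u _.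
  by rewrite /bessel_kernel /gamma_kernel mul0r subr0 mul1r.
have {}r0 : 0 < kap * norm2 v.
  by rewrite lt0r r0 mulr_ge0 ?sqrtr_ge0 ?ltW.
rewrite Rintegral_bessel_kernel//; set r := kap * norm2 v in r0 *.
have -> : (r / 2) `^ nu = r `^ nu / 2 `^ nu.
  by rewrite powRM ?invr_ge0// ?(ltW r0)// -powR_inv1// -powRrM mulN1r powRN.
have -> : 2 `^ nu = 2 * 2 `^ (nu - 1) :> R.
  by rewrite -[X in X * _]powRr1// -powRD ?pnatr_eq0 ?implybT//; congr powR; ring.
by field; rewrite !gt_eqF// powR_gt0.
Qed.

(** The value of [eta] is the one for which the constants of Poisson's formula
    combine into the variance of the Matern covariance. *)
Lemma eta_sqE L : 0 < L ->
  eta_sq d sigma nu rho * (L ^- d / (Num.sqrt (laplace_coef L / pi) ^+ d * Gamma (alpha d nu)))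
  = sigma ^+ 2 / Gamma nu.
Proof.
move=> L0; have k0 := kappa_gt0; have p0 := pi_gt0 R.
have g0 := Gamma_gt0 nu0; have a0 : 0 < Gamma (alpha d nu) by apply: Gamma_gt0; exact: alpha_gt0.
have s0 : 0 < Num.sqrt (4 * pi) :> R by rewrite sqrtr_gt0 mulr_gt0.
have -> : Num.sqrt (laplace_coef L / pi) = Num.sqrt (4 * pi) / (kap * L).
  have kL : 0 <= kap * L by rewrite mulr_ge0// ltW.
  rewrite -[kap * L]ger0_norm// -sqrtr_sqr -sqrtrV ?sqr_ge0// -sqrtrM ?mulr_ge0 ?ltW//.
  congr Num.sqrt; rewrite /laplace_coef; move: (gt_eqF p0); generalize (pi : R) => p hp.
  by field; rewrite hp !gt_eqF.
rewrite /eta_sq -/kap -/(alpha d nu).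
have -> : (4 * pi) `^ (d%:R / 2) = Num.sqrt (4 * pi) ^+ d :> R.
  have p4 : 0 <= 4 * pi :> R by rewrite mulr_ge0 ?ltW.
  by rewrite [d%:R / 2]mulrC powRrM -powR12_sqrt// powR_mulrn// powR_ge0.
move: k0; generalize kap => k k0; rewrite expr_div_n exprMn; field.
by rewrite !expf_neq0 ?gt_eqF.
Qed.

(** Poisson summation in the original scaling, with the normalisation of
    [eta_sqE]; [x] and [y] are arbitrary because the reflected points
    [hadamard (signs R b) y] lie outside the domain. *)
Lemma has_usum_periodic L x y eta : 0 < L -> eta ^+ 2 = eta_sq d sigma nu rho ->
  exists2 p : R, has_usum (termP nu rho L x y) p%:C &
    has_usum (fun k : 'rV[int]_d => matern_cov sigma nu rho (x + L *: intvec R k) y)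
      (eta ^+ 2 * p).
Proof.
move=> L0 etaE; have c0 := laplace_coef_gt0 L0.
have [J [h1 h2 h3]] := has_usum_resolvent_matern d0 c0 nu0 (L^-1 *: (x - y)).
exists (L ^- d * (J / (Num.sqrt (laplace_coef L / pi) ^+ d * Gamma (alpha d nu)))).
  have := has_usum_complex (has_usumZ (c := L ^- d) h1) (has_usumZ (c := L ^- d) h2).
  rewrite mulr0; apply: has_usum_ext => k; rewrite termPE//.
  by rewrite /expi; apply/eqP; rewrite eq_complex /=; apply/andP; split; apply/eqP; ring.
rewrite etaE.
have -> : eta_sq d sigma nu rho *
    (L ^- d * (J / (Num.sqrt (laplace_coef L / pi) ^+ d * Gamma (alpha d nu)))) =
    sigma ^+ 2 / Gamma nu * J.
  by rewrite -(eta_sqE L0); ring.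
by apply: has_usum_ext (has_usumZ (c := sigma ^+ 2 / Gamma nu) h3) => k; rewrite matern_covE.
Qed.

End periodic.

(** * Images and orthants *)

Section orthant_fibers.
Variable d : nat.
Implicit Types (m : 'rV[nat]_d) (b : 'rV[bool]_d).

(** A vanishing coordinate has no sign; its bit is required to be [false] so that
    [signed m] is injective on the admissible bit vectors. *)
Definition sign_choice m b : bool :=
  [forall i, (m ord0 i == 0)%N ==> ~~ b ord0 i].

Definition signed m b : 'rV[int]_d := \row_i ((-1) ^+ b ord0 i * (m ord0 i)%:Z).

(** The multi-indices of [Z^d] with absolute values [m]. *)
Definition orthant_fiber m : {fset 'rV[int]_d} :=
  [fset signed m b | b in {: 'rV[bool]_d} & sign_choice m b]%fset.

Lemma absz_signed m b i : absz (signed m b ord0 i) = m ord0 i.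
Proof. by rewrite mxE; case: (b ord0 i); rewrite ?expr1 ?expr0; lia. Qed.

Lemma signed_inj m : {in sign_choice m &, injective (signed m)}.
Proof.
move=> b b' /forallP hb /forallP hb' /rowP e; apply/rowP => i.
have := e i; rewrite !mxE; have := hb i; have := hb' i.
change (b 0 i) with (b ord0 i); change (b' 0 i) with (b' ord0 i).
by case: (b ord0 i); case: (b' ord0 i); case: (m ord0 i) => // n _ _;
  rewrite ?expr1 ?expr0; lia.
Qed.

Lemma orthant_fiber_disjoint (k : 'rV[int]_d) m m' :
  k \in orthant_fiber m -> k \in orthant_fiber m' -> m = m'.
Proof.
move=> /imfsetP[b _ ->] /imfsetP[b' _ e]; apply/rowP => i.
by have := absz_signed m b i; rewrite e absz_signed.
Qed.

Lemma orthant_fiber_abs (k : 'rV[int]_d) :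
  k \in orthant_fiber (\row_i absz (k ord0 i)).
Proof.
apply/imfsetP; exists (\row_i (k ord0 i < 0)) => /=.
  rewrite unfold_in; apply/forallP => i; rewrite !mxE; apply/implyP => /eqP; lia.
apply/rowP => i; rewrite !mxE; change (k 0 i) with (k ord0 i).
by case: (ltP (k ord0 i) 0) => h; rewrite ?expr1 ?expr0; lia.
Qed.

(** Over the sign changes of [m] a product of functions of the coordinates sums to a
    product of sums with one or two terms. *)
Lemma sum_orthant_fiber (K : comPzRingType) m (F : 'I_d -> int -> K) :
  \sum_(k <- orthant_fiber m) \prod_i F i (k ord0 i) =
  \prod_i \sum_(b : bool | (m ord0 i == 0)%N ==> ~~ b) F i ((-1) ^+ b * (m ord0 i)%:Z).
Proof.
rewrite -(sum_rV_prod (fun i (c : bool) => (m ord0 i == 0)%N ==> ~~ c)).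
rewrite big_imfset /=; last exact: signed_inj.
transitivity (\sum_(b | sign_choice m b) \prod_i F i (signed m b ord0 i)).
  by rewrite big_filter big_enum_cond; apply: eq_bigl => b; rewrite inE.
by apply: eq_bigr => b _; apply: eq_bigr => i _; rewrite mxE.
Qed.

End orthant_fibers.

Section images_1d.
Context {R : realType}.
Variables (L : R) (sg : bool -> R).
Implicit Types (k : int) (x y : R).

(** One coordinate of the signed sum of plane waves over the two images [y] and
    [- y], with weights [sg]: constant for Neumann, alternating for Dirichlet. *)
Definition image_wave x y k : R[i] :=
  \sum_b (sg b)%:C * expi (pi / L * k%:~R * (x - (-1) ^+ b * y)).

End images_1d.

(** [2 cos (s - t) + 2 cos (s + t) = 4 cos s cos t], with [4 / (2 L)] the square of
    [acoef L n]. For [n = 0] the fiber has one point instead of two and the sum is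
    [2], which is why [acoef L 0] is smaller. *)
Lemma neumann_1d (R : realType) (L x y : R) (n : nat) : 0 < L ->
  ((2 * L)^-1)%:C * \sum_(b : bool | (n == 0)%N ==> ~~ b)
    image_wave L (fun=> 1) x y ((-1) ^+ b * n%:Z) =
  ((acoef L n * cos (pi * n%:R * x / L)) * (acoef L n * cos (pi * n%:R * y / L)))%:C.
Proof.
move=> L0; rewrite mulrACA -expr2 /acoef sqr_sqrtr; last by case: ifP => _; rewrite divr_ge0// ltW.
rewrite big_mkcond big_bool /= /image_wave !big_bool /= !expr1 !expr0 !mul1r !mulN1r opprK.
set s := pi * n%:R * x / L; set t := pi * n%:R * y / L.
have e1 : pi / L * (n%:Z)%:~R * (x + y) = s + t by rewrite /s /t -[_%:~R]/(n%:R); ring.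
have e2 : pi / L * (n%:Z)%:~R * (x - y) = s - t by rewrite /s /t -[_%:~R]/(n%:R); ring.
rewrite e1 e2 mulrNz mulrN !mulNr e1 e2.
have [n0|n0] := eqVneq n 0%N.
  have -> : s = 0 by rewrite /s n0; ring.
  have -> : t = 0 by rewrite /t n0; ring.
  rewrite subr0 addr0 expi0 cos0 /=; apply/eqP; rewrite eq_complex /=.
  by apply/andP; split; apply/eqP; field; rewrite gt_eqF.
rewrite /= /expi opprB !cosN !sinN !cosD !sinD !cosN !sinN; apply/eqP; rewrite eq_complex /=.
by apply/andP; split; apply/eqP; field; rewrite gt_eqF.
Qed.

(** [2 cos (s - t) - 2 cos (s + t) = 4 sin s sin t]. *)
Lemma dirichlet_1d (R : realType) (L x y : R) (n : nat) : 0 < L -> (0 < n)%N ->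
  ((2 * L)^-1)%:C * \sum_(b : bool | (n == 0)%N ==> ~~ b)
    image_wave L (fun b : bool => (-1) ^+ b) x y ((-1) ^+ b * n%:Z) =
  ((acoef L n * sin (pi * n%:R * x / L)) * (acoef L n * sin (pi * n%:R * y / L)))%:C.
Proof.
move=> L0 n0; rewrite mulrACA -expr2 /acoef sqr_sqrtr; last by case: ifP => _; rewrite divr_ge0// ltW.
rewrite (gtn_eqF n0).
rewrite big_mkcond big_bool /= /image_wave !big_bool /= !expr1 !expr0 !mul1r !mulN1r opprK.
set s := pi * n%:R * x / L; set t := pi * n%:R * y / L.
have e1 : pi / L * (n%:Z)%:~R * (x + y) = s + t by rewrite /s /t -[_%:~R]/(n%:R); ring.
have e2 : pi / L * (n%:Z)%:~R * (x - y) = s - t by rewrite /s /t -[_%:~R]/(n%:R); ring.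
rewrite e1 e2 mulrNz mulrN !mulNr e1 e2.
rewrite /expi opprB !cosN !sinN !cosD !sinD !cosN !sinN; apply/eqP; rewrite eq_complex /=.
by apply/andP; split; apply/eqP; field; rewrite gt_eqF.
Qed.

(** * The Neumann and Dirichlet covariances *)

Section images.
Context {R : realType}.
Variables (d : nat) (nu rho L : R).
Hypothesis L0 : 0 < L.
Implicit Types (x y : 'rV[R]_d) (k : 'rV[int]_d) (m : 'rV[nat]_d) (sg : bool -> R).

Let kap := kappa nu rho.

Definition image_term sg x y k : R[i] :=
  (((2 * L) ^- d) * resolvent (laplace_coef nu rho (2 * L)) nu k)%:C *
  \prod_i image_wave L sg (x ord0 i) (y ord0 i) (k ord0 i).

(** The product over the coordinates of the two-point image sums expands into
    the signed sum over all sign vectors. *)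
Lemma has_usum_image_term sg x y (p : 'rV[bool]_d -> R) :
  (forall b, has_usum (termP nu rho (2 * L) x (hadamard (signs R b) y)) (p b)%:C) ->
  has_usum (image_term sg x y) (\sum_(b : 'rV[bool]_d) (\prod_i sg (b ord0 i))%:C * (p b)%:C).
Proof.
move=> hp; apply: has_usum_ext (has_usum_sum (fun b : 'rV[bool]_d => has_usumZ (c := (\prod_i sg (b ord0 i))%:C) (hp b))) => k.
rewrite /image_term /image_wave.
rewrite -(sum_rV_prod (fun _ => predT)
  (fun i b => (sg b)%:C * expi (pi / L * (k ord0 i)%:~R * (x ord0 i - (-1) ^+ b * y ord0 i)))).
rewrite mulr_sumr; apply: eq_big => [b|b _]; first by apply/esym/forallP.
rewrite termPE ?mulr_gt0// big_split /= rmorph_prod mulrCA; congr (_ * (_ * _)).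
rewrite -expi_sum; congr expi; rewrite /freq /dotp mulr_sumr.
by apply: eq_bigr => i _; rewrite !mxE; field; rewrite gt_eqF.
Qed.

Lemma resolvent_orthant_fiber m k : k \in orthant_fiber m ->
  resolvent (laplace_coef nu rho (2 * L)) nu k = lamN kap L m `^ (- alpha d nu).
Proof.
move=> /imfsetP[b _ ->]; rewrite /resolvent /lamN; congr (_ `^ _); congr (1 + _).
have -> : sqnorm2 (intvec R (signed m b)) = sqnorm2 (natvec R m).
  apply: eq_bigr => i _; rewrite !mxE.
  by case: (b ord0 i); rewrite ?expr1 ?expr0 ?mulN1r ?mul1r ?mulrNz ?sqrrN.
congr (_ * _); rewrite /laplace_coef -/kap; congr (_ ^+ 2).
by rewrite mulrCA -mulf_div divff ?mul1r// pnatr_eq0.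
Qed.

Lemma sum_image_term_fiber sg x y m (w : 'I_d -> R) :
  (forall i, ((2 * L)^-1)%:C * \sum_(b : bool | (m ord0 i == 0)%N ==> ~~ b)
     image_wave L sg (x ord0 i) (y ord0 i) ((-1) ^+ b * (m ord0 i)%:Z) = (w i)%:C) ->
  \sum_(k <- orthant_fiber m) image_term sg x y k =
  (lamN kap L m `^ (- alpha d nu) * \prod_i w i)%:C.
Proof.
move=> hw; rewrite big_seq.
under eq_bigr => k km do rewrite /image_term (resolvent_orthant_fiber km).
rewrite -big_seq -mulr_sumr.
rewrite (sum_orthant_fiber m (fun i => image_wave L sg (x ord0 i) (y ord0 i))).
rewrite [RHS]rmorphM [in LHS]mulrC rmorphM /= mulrCA mulrA [RHS]mulrC; congr (_ * _).
rewrite rmorph_prod /=; under [RHS]eq_bigr do rewrite -hw.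
rewrite big_split /= prodr_const card_ord; congr (_ * _).
by rewrite -exprVn rmorphXn.
Qed.

(** Regrouping the series over [Z^d] by absolute values gives the cosine series. *)
Lemma has_usum_neumann x y (p : 'rV[bool]_d -> R) :
  (forall b, has_usum (termP nu rho (2 * L) x (hadamard (signs R b) y)) (p b)%:C) ->
  has_usum (termN nu rho L x y) (\sum_b (p b)%:C).
Proof.
move=> hp; have h := has_usum_image_term (sg := fun=> 1) hp.
have {}h : has_usum (image_term (fun=> 1) x y) (\sum_b (p b)%:C).
  rewrite (eq_bigr (fun b : 'rV[bool]_d =>
    (\prod_(i < d) (1 : R))%:C * (p b)%:C)) // => b _.
  by rewrite big1 ?mul1r.
have cov k : image_term (fun=> 1) x y k != 0 -> exists m, k \in orthant_fiber m.
  by move=> _; exists (\row_i absz (k ord0 i)); exact: orthant_fiber_abs.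
have := has_usum_regroup (@orthant_fiber_disjoint d) cov h.
apply: has_usum_ext => m.
rewrite (sum_image_term_fiber (fun i => @neumann_1d R L (x ord0 i) (y ord0 i) (m ord0 i) L0)) big_split /=.
rewrite /termN /green_term /wN -/kap; apply/eqP; rewrite eq_complex /=.
by apply/andP; split; apply/eqP; ring.
Qed.

(** The alternating image sum vanishes as soon as one [k_i] does, so that the fibers
    over positive multi-indices cover the support. *)
Lemma has_usum_dirichlet x y (p : 'rV[bool]_d -> R) :
  (forall b, has_usum (termP nu rho (2 * L) x (hadamard (signs R b) y)) (p b)%:C) ->
  has_usum (termD nu rho L x y) (\sum_(b : 'rV[bool]_d) (\prod_i signs R b ord0 i)%:C * (p b)%:C).
Proof.
move=> hp; have h := has_usum_image_term (sg := fun b : bool => (-1) ^+ b) hp.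
have {}h : has_usum (image_term (fun b : bool => (-1) ^+ b) x y)
    (\sum_(b : 'rV[bool]_d) (\prod_i signs R b ord0 i)%:C * (p b)%:C).
  rewrite (eq_bigr (fun b : 'rV[bool]_d =>
    (\prod_i (-1) ^+ b ord0 i)%:C * (p b)%:C)) // => b _.
  by congr (_%:C * _); apply: eq_bigr => i _; rewrite mxE.
pose fib (m : posmulti d) := orthant_fiber (val m).
have disj k (m m' : posmulti d) : k \in fib m -> k \in fib m' -> m = m'.
  by move=> h1 h2; apply/val_inj/(orthant_fiber_disjoint h1 h2).
have cov k : image_term (fun b : bool => (-1) ^+ b) x y k != 0 -> exists m : posmulti d, k \in fib m.
  move=> nz; have pos : [forall i, (0 < (\row_i absz (k ord0 i) : 'rV[nat]_d) ord0 i)%N].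
    apply/forallP => i; rewrite mxE absz_gt0; apply: contraNneq nz => ki.
    rewrite /image_term (bigD1 i) //= ki /image_wave big_bool /= expr1 expr0.
    rewrite !mulr0 !mul0r expi0 mulr1 mulr1.
    by rewrite -rmorphD /= addNr mul0r mulr0.
  exists (exist (fun m : 'rV[nat]_d => [forall i, (0 < m ord0 i)%N]) _ pos).
  exact: orthant_fiber_abs.
have := has_usum_regroup disj cov h; apply: has_usum_ext => m.
have mp i : (0 < val m ord0 i)%N by have /forallP := valP m; exact.
rewrite (sum_image_term_fiber (fun i => @dirichlet_1d R L (x ord0 i) (y ord0 i) _ L0 (mp i))) big_split /=.
rewrite /termD /green_term /wD /lamD -/kap; apply/eqP; rewrite eq_complex /=.
by apply/andP; split; apply/eqP; ring.
Qed.

End images.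

(** * The three representations *)

Theorem theorem2p1 (R : realType) (d : nat) (sigma nu rho L eta : R)
    (hd : (1 <= d <= 3)%N) (hsigma : 0 < sigma ^+ 2) (hnu : 0 < nu)
    (hrho : 0 < rho) (hL : 0 < L)
    (heta : 0 < eta) (heta2 : eta ^+ 2 = eta_sq d sigma nu rho)
    (x y : 'rV[R]_d) (hx : Dext L x) (hy : Dext L y) :
  let C := @matern_cov R d sigma nu rho in
  let CP := @covP R d nu rho eta in
  let CN := @covN R d nu rho eta in
  let CD := @covD R d nu rho eta in
  (* all the series below, and those defining the covariances, converge *)
  ([/\ usummable (termP nu rho L x y),
       usummable (termN nu rho L x y),
       usummable (termD nu rho L x y) &
       usummable (fun k : 'rV[int]_d => C (x + L *: intvec R k) y)] /\
   (forall b : 'rV[bool]_d,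
      usummable (termP nu rho (2 * L) x (hadamard (signs R b) y)) /\
      usummable (fun k : 'rV[int]_d =>
        C (x + (2 * L) *: intvec R k) (hadamard (signs R b) y)))) /\
  [/\ CP L x y = (usum (fun k : 'rV[int]_d => C (x + L *: intvec R k) y))%:C,
      CN L x y = \sum_(b : 'rV[bool]_d) CP (2 * L) x (hadamard (signs R b) y),
      CN L x y = (\sum_(b : 'rV[bool]_d) usum (fun k : 'rV[int]_d =>
          C (x + (2 * L) *: intvec R k) (hadamard (signs R b) y)))%:C,
      CD L x y = \sum_(b : 'rV[bool]_d)
          (\prod_i signs R b ord0 i)%:C
            * CP (2 * L) x (hadamard (signs R b) y) &
      CD L x y = (\sum_(b : 'rV[bool]_d)
          (\prod_i signs R b ord0 i) * usum (fun k : 'rV[int]_d =>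
            C (x + (2 * L) *: intvec R k) (hadamard (signs R b) y)))%:C].
Proof.
have d0 : (0 < d)%N by case/andP: hd.
have hP L' (y' : 'rV[R]_d) (hL' : 0 < L') := has_usum_periodic d0 hnu hrho x y' hL' heta2.
have L2 : 0 < 2 * L by rewrite mulr_gt0.
have [p hp hm] := hP L y hL.
have /choice[q hq] b : exists q : R,
    has_usum (termP nu rho (2 * L) x (hadamard (signs R b) y)) q%:C /\
    has_usum (fun k : 'rV[int]_d => matern_cov sigma nu rho
      (x + (2 * L) *: intvec R k) (hadamard (signs R b) y)) (eta ^+ 2 * q).
  by have [q' h1 h2] := hP _ (hadamard (signs R b) y) L2; exists q'.
have hN := has_usum_neumann hL (fun b => (hq b).1).
have hD := has_usum_dirichlet hL (fun b => (hq b).1).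
have CPE b : covP nu rho eta (2 * L) x (hadamard (signs R b) y) = (eta ^+ 2 * q b)%:C.
  by rewrite /covP /green_cov (has_usum_usum (hq b).1) [RHS]rmorphM.
move=> C CP CN CD; split.
  split=> [|b]; first split.
  - exact: has_usum_usummable hp.
  - exact: has_usum_usummable hN.
  - exact: has_usum_usummable hD.
  - exact: has_usum_usummable hm.
  by have [h1 h2] := hq b; split; [exact: has_usum_usummable h1|exact: has_usum_usummable h2].
have CNE : CN L x y = \sum_b (eta ^+ 2 * q b)%:C.
  rewrite /CN /covN /green_cov (has_usum_usum hN) mulr_sumr.
  by apply: eq_bigr => b _; rewrite [RHS]rmorphM.
have CDE : CD L x y = \sum_(b : 'rV[bool]_d) (\prod_i signs R b ord0 i)%:C * (eta ^+ 2 * q b)%:C.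
  rewrite /CD /covD /green_cov (has_usum_usum hD) mulr_sumr.
  by apply: eq_bigr => b _; rewrite [in RHS]rmorphM /= mulrCA.
split.
- by rewrite /CP /covP /green_cov (has_usum_usum hp) (has_usum_usum hm) [RHS]rmorphM.
- by rewrite CNE; apply: eq_bigr => b _; rewrite -CPE.
- rewrite CNE rmorph_sum; apply: eq_bigr => b _.
  by rewrite (has_usum_usum (hq b).2).
- by rewrite CDE; apply: eq_bigr => b _; rewrite -CPE.
- rewrite CDE rmorph_sum; apply: eq_bigr => b _.
  by rewrite (has_usum_usum (hq b).2) [RHS]rmorphM.
Qed.
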